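(* Let $\pi$ be a (quasi)minuscule coweight for $R$ and let $D^\pi$ be the corresponding Macdonald operator with parameters $t_\alpha=q^{-m_\alpha}$ (i.e. $k_\alpha=-m_\alpha$), where all $m_\alpha\in\mathbb Z_{\ge 0}$. Let $\mathfrak R$ be the ring of all polynomials $f(x)=\sum_{\nu\in P}f_\nu q^{2(\nu,x)}$ (finite sums) such that for each $\alpha\in R_+$ and each $j=1,\dots,m_\alpha$ $$f\left(x+\tfrac12 j\alpha^\vee\right)=f\left(x-\tfrac12 j\alpha^\vee\right)\quad\text{for all } x \text{ with } q^{2(\alpha,x)}=1 .$$ Then $D^\pi$ preserves $\mathfrak R$: $D^\pi(\mathfrak R)\subseteq\mathfrak R$.
   Context: $V=\mathbb R^n$ is a Euclidean space with scalar product $(\cdot,\cdot)$, extended complex-bilinearly to $V\otimes\mathbb C$; variables $x$ range over $V\otimes\mathbb C$. $R\subset V$ is a reduced irreducible root system of rank $n$, $R_+$ a set of positive roots, $W$ the Weyl group, $\alpha^\vee=2\alpha/(\alpha,\alpha)$, $R^\vee=\{\alpha^\vee\}$, $P=\{\pi\in V: (\pi,\alpha^\vee)\in\mathbb Z\ \forall\alpha\in R\}$ the weight lattice, $P^\vee=\{\pi\in V:(\pi,\alpha)\in\mathbb Z\ \forall\alpha\in R\}$ the coweight lattice. $q\in\mathbb C^\times$ is not a root of unity; $\log q$ is fixed and $q^a=e^{a\log q}$. The multiplicities $m_\alpha$ are $W$-invariant: $m_{w\alpha}=m_\alpha$. A coweight $\pi\in P^\vee$ is minuscule if $-1\le(\pi,\alpha)\le1$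 for all $\alpha\in R$; it is quasiminuscule if $\pi\in R^\vee$ and $-1\le(\pi,\alpha)\le 1$ for all $\alpha\in R\setminus\{\pm\pi^\vee\}$, where $\pi^\vee=2\pi/(\pi,\pi)$. ''(Quasi)minuscule'' means nonzero and either minuscule or quasiminuscule. $(T^vf)(x)=f(x+v)$. For $W$-invariant parameters $k_\alpha$, $t_\alpha=q^{k_\alpha}$, $\rho_k=\frac12\sum_{\alpha\in R_+}k_\alpha\alpha$, the Macdonald operator is $$D^\pi=\sum_{\tau\in W\pi}a_\tau(T^\tau-1)+\sum_{\tau\in W\pi}q^{-2(\rho_k,\tau)},$$ $$a_\tau(x)=\prod_{\alpha\in R,\,(\alpha,\tau)>0}\frac{t_\alpha q^{(\alpha,x)}-t_\alpha^{-1}q^{-(\alpha,x)}}{q^{(\alpha,x)}-q^{-(\alpha,x)}}\ \prod_{\alpha\in R,\,(\alpha,\tau)=2}\frac{t_\alpha q^{1+(\alpha,x)}-t_\alpha^{-1}q^{-1-(\alpha,x)}}{q^{1+(\alpha,x)}-q^{-1-(\alpha,x)}} .$$ For minuscule $\pi$ the second product is empty and $D^\pi=\sum_{\tau\in W\pi}a_\tau T^\tau$. *)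

(* Defs.v *)
From HB Require Import structures.
From mathcomp Require Import all_boot all_order all_algebra.
From mathcomp Require Import finmap complex.
From mathcomp Require Import all_classical all_reals all_analysis.

Set Implicit Arguments.
Unset Strict Implicit.
Unset Printing Implicit Defensive.

Import Order.TTheory GRing.Theory Num.Theory.

Local Open Scope classical_set_scope.
Local Open Scope ring_scope.
Local Open Scope complex_scope.

Definition cexp (R : realType) (z : R[i]) : R[i] :=
  (expR (complex.Re z))%:C * (cos (complex.Im z) +i* sin (complex.Im z)).

(* Bilinear form with Gram matrix G.  It is used over the reals for the scalar
   product and, with the same Gram matrix mapped to R[i], for its bilinear (not
   sesquilinear) extension to the complexification. *)
Definition bil (K : nzRingType) (n : nat) (G : 'M[K]_n) (u v : 'rV[K]_n) : K :=
  (u *m G *m v^T) ord0 ord0.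

Definition cplx (R : realType) (m n : nat) (A : 'M[R]_(m, n)) : 'M[R[i]]_(m, n) :=
  map_mx (real_complex R) A.

Section RootSystems.
Variables (R : realType) (n : nat) (G : 'M[R]_n).
Local Notation V := 'rV[R]_n.

Definition scalar_product : Prop :=
  G^T = G /\ forall v : V, v != 0 -> 0 < bil G v v.

Definition coroot (a : V) : V := (2 / bil G a a) *: a.

Definition reflection (a v : V) : V := v - bil G v (coroot a) *: a.

Variable Phi : {fset V}.

Definition root_system : Prop :=
  [/\ 0 \notin Phi,
      <<(Phi : seq V)>>%VS = fullv,
      forall a b : V, a \in Phi -> b \in Phi -> reflection a b \in Phi
    & forall a b : V, a \in Phi -> b \in Phi -> bil G b (coroot a) \is a Num.int].

Definition reduced_root_system : Prop :=
  forall (a : V) (c : R), a \in Phi -> c *: a \in Phi -> c = 1 \/ c = -1.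

Definition irreducible_root_system : Prop :=
  Phi != fset0 /\
  forall A B : {fset V}, Phi = (A `|` B)%fset ->
    (forall a b : V, a \in A -> b \in B -> bil G a b = 0) ->
    A = fset0 \/ B = fset0.

Definition positive_roots (Phip : {fset V}) : Prop :=
  [/\ (Phip `<=` Phi)%fset,
      forall a : V, a \in Phi -> (a \in Phip) (+) (- a \in Phip)
    & forall a b : V, a \in Phip -> b \in Phip -> a + b \in Phi -> a + b \in Phip].

(* Reflections are involutions, so closing under composition is enough to get
   the group they generate. *)
Inductive weyl_group : set (V -> V) :=
| weyl_id : weyl_group idfun
| weyl_refl (a : V) (w : V -> V) :
    a \in Phi -> weyl_group w -> weyl_group (reflection a \o w).

Definition weyl_orbit (v : V) : set V := [set w v | w in weyl_group].

Definition weyl_invariant (T : Type) (m : V -> T) : Prop :=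
  forall (w : V -> V) (a : V), weyl_group w -> a \in Phi -> m (w a) = m a.

Definition weight_lattice : set V :=
  [set v | forall a : V, a \in Phi -> bil G v (coroot a) \is a Num.int].

Definition coweight_lattice : set V :=
  [set v | forall a : V, a \in Phi -> bil G v a \is a Num.int].

Definition minuscule (v : V) : Prop :=
  coweight_lattice v /\ forall a : V, a \in Phi -> -1 <= bil G v a <= 1.

Definition quasiminuscule (v : V) : Prop :=
  (exists2 a : V, a \in Phi & v = coroot a) /\
  forall a : V, a \in Phi -> a != coroot v -> a != - coroot v ->
    -1 <= bil G v a <= 1.

Definition minuscule_or_quasi (v : V) : Prop :=
  v != 0 /\ (minuscule v \/ quasiminuscule v).

End RootSystems.

Section Macdonald.
Variables (R : realType) (n : nat) (G : 'M[R]_n) (Phi Phip : {fset 'rV[R]_n}).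
Variable logq : R[i].
Local Notation V := 'rV[R]_n.
Local Notation VC := 'rV[R[i]]_n.

Definition qpow (z : R[i]) : R[i] := cexp (z * logq).

Definition pairC (u v : VC) : R[i] := bil (cplx G) u v.

Section Operator.
Variable k : V -> R[i].

Definition rho : VC := 2^-1 *: \sum_(a <- Phip) k a *: cplx a.

(* The factor of the coefficient attached to a root a, where z stands for (a, x)
   in the first product and for 1 + (a, x) in the second; t_a = q^(k a). *)
Definition macd_den (z : R[i]) : R[i] := qpow z - qpow (- z).

Definition macd_num (a : V) (z : R[i]) : R[i] :=
  qpow (k a) * qpow z - (qpow (k a))^-1 * qpow (- z).

Definition macd_coef (tau : V) (x : VC) : R[i] :=
  (\prod_(a <- Phi | 0 < bil G a tau)
      (macd_num a (pairC (cplx a) x) / macd_den (pairC (cplx a) x))) *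
  (\prod_(a <- Phi | bil G a tau == 2)
      (macd_num a (1 + pairC (cplx a) x) / macd_den (1 + pairC (cplx a) x))).

(* The sums range over the Weyl orbit, which is finite.  Division is total, so
   the value is only meaningful at points satisfying macd_regular below. *)
Definition macdonald (pi : V) (f : VC -> R[i]) (x : VC) : R[i] :=
  \sum_(tau \in weyl_orbit G Phi pi)
      (macd_coef tau x * (f (x + cplx tau) - f x))
  + (\sum_(tau \in weyl_orbit G Phi pi) qpow (- (2 * pairC rho (cplx tau)))) * f x.

End Operator.

Definition macd_regular (pi : V) (x : VC) : Prop :=
  forall tau a : V, weyl_orbit G Phi pi tau -> a \in Phi ->
    (0 < bil G a tau -> macd_den (pairC (cplx a) x) != 0) /\
    (bil G a tau = 2 -> macd_den (1 + pairC (cplx a) x) != 0).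

Definition weight_polynomial (f : VC -> R[i]) : Prop :=
  exists (S : {fset V}) (c : V -> R[i]),
    (forall nu : V, nu \in S -> weight_lattice G Phi nu) /\
    forall x : VC, f x = \sum_(nu <- S) c nu * qpow (2 * pairC (cplx nu) x).

Definition quasi_invariants (m : V -> nat) : set (VC -> R[i]) :=
  [set f | weight_polynomial f /\
    forall (a : V) (j : nat), a \in Phip -> (1 <= j <= m a)%N ->
    forall x : VC, qpow (2 * pairC (cplx a) x) = 1 ->
      f (x + (j%:R / 2) *: cplx (coroot G a)) =
      f (x - (j%:R / 2) *: cplx (coroot G a))].

(* D f, a priori only defined where its coefficients have no poles, belongs to
   the set Q of entire functions. *)
Definition macdonald_image_in (k : V -> R[i]) (pi : V) (f : VC -> R[i])
    (Q : set (VC -> R[i])) : Prop :=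
  exists2 g : VC -> R[i], Q g &
    forall x : VC, macd_regular pi x -> macdonald k pi f x = g x.

End Macdonald.

(* Main.v *)
Require Import Defs.
From HB Require Import structures.
From mathcomp Require Import all_boot all_order all_algebra.
From mathcomp Require Import finmap complex.
From mathcomp Require Import all_classical all_reals all_analysis.
From mathcomp Require Import ring lra zify.

(** The operator D is cleared of denominators and everything takes place in the
    ring of weight polynomials, whose elements are finite sums of characters
    chi_nu (x) = q^(2 (nu, x)). The relevant prime-like elements are the walls
    chi_a - q^(2 g) for a root a and an integer g.

    For a root a with reflection s, translations by multiples c a^vee with
    q^(2 c) = 1 are periods, so quasi-invariance of f says that F = f - f o s
    vanishes on the walls chi_a = q^(2 j) with |j| <= m_a [quasi_invariantP,
    skew_part_vanishes]. The operator is W-equivariant [numerator_creflection],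
    so D f - (D f) o s = D F.

    D f has no poles. A pole on chi_a = 1 has order at most one, but both a and
    - a contribute their wall to the common denominator, so the cleared operator
    has to vanish twice there. On the even part (f + f o s) / 2 this holds by
    symmetry [even_divides]. On F each term a_tau (x) F (x + tau) is regular:
    x + tau lies on the wall of index (a, tau), where F vanishes unless
    |(a, tau)| > m_a, and then a numerator t q^(a, x) - t^(-1) q^(-(a, x)) of a_tau vanishes
    [factors_cancel]. A pole on chi_a = q^(-2) occurs only for tau = a^vee, and
    is killed by f (x + a^vee) = f (x) [divides_numeratorN1].

    D f is quasi-invariant. On chi_a = q^(2 j) with 1 <= j <= m_a the same
    argument shows that every term of D F vanishes: either
    j + (a, tau) <= m_a and F (x + tau) = 0, or a numerator of a_tau is zero.
    The one exception is the coefficient of tau = - a^vee, which has a pole for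
    j = 1; there F (x - a^vee) - F (x) is even under the reflection in the
    hyperplane (a, x) = 1, hence vanishes to second order
    [divides_numerator1_skew].

    Passing from these zeros to divisibility needs a Nullstellensatz for a single
    wall [wall_divides], which is Dedekind's independence of characters, and the
    fact that distinct walls may be cancelled [coprime_walls]. The latter usually
    is a density argument; here it is reduced to the remark that an exponential
    sum vanishing at all large integers vanishes identically
    [exponential_sum_eq0]. *)

Set Implicit Arguments.
Unset Strict Implicit.
Unset Printing Implicit Defensive.

Import Order.TTheory GRing.Theory Num.Theory.

Local Open Scope ring_scope.
Local Open Scope complex_scope.

(** * Exponential sums and characters *)

Section Exponentials.

(** The operator E |-> E (k + 1) - l * E k removes the term of ratio l, so by
    induction E itself is a geometric progression, which cannot vanish once
    without vanishing always. This replaces every limit or genericity argument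
    below. *)
Lemma exponential_sum_eq0 (K : fieldType) (s : seq (K * K)) (N : nat) :
  (forall p, p \in s -> p.2 != 0) ->
  (forall k, (N <= k)%N -> \sum_(p <- s) p.1 * p.2 ^+ k = 0) ->
  forall k, \sum_(p <- s) p.1 * p.2 ^+ k = 0.
Proof.
have [n] := ubnP (size s); elim: n s N => // n IHn [|[d l] s] N /= sn nz H k.
  by rewrite big_nil.
have l0 : l != 0 by exact: (nz (d, l) (mem_head _ _)).
pose E j := \sum_(p <- (d, l) :: s) p.1 * p.2 ^+ j.
have shiftE j : E j.+1 - l * E j =
    \sum_(p <- [seq (p.1 * (p.2 - l), p.2) | p <- s]) p.1 * p.2 ^+ j.
  rewrite /E !big_cons /= big_map mulrDr opprD addrACA.
  rewrite [X in X + _](_ : _ = 0); last by rewrite exprS; ring.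
  rewrite add0r mulr_sumr -sumrB; apply: eq_bigr => p _ /=.
  by rewrite exprS; ring.
have stepE j : E j.+1 = l * E j.
  apply/eqP; rewrite -subr_eq0 shiftE; apply/eqP; apply: (IHn _ N).
  - by rewrite size_map.
  - by move=> p /mapP[p' p's ->] /=; apply: nz; rewrite inE p's orbT.
  - by move=> i Ni; rewrite -shiftE /E !H ?mulr0 ?subr0// leqW.
have powE j : E j = l ^+ j * E 0%N.
  elim: j => [|j IHj]; first by rewrite expr0 mul1r.
  by rewrite stepE IHj exprS mulrA.
suff E0 : E 0%N = 0 by rewrite -/(E k) powE E0 mulr0.
have /eqP := H N (leqnn N); rewrite -/(E N) powE mulf_eq0 expf_eq0.
by rewrite (negPf l0) andbF /= => /eqP.
Qed.

(** Dedekind's argument: a relation, minus its translate by a point separating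
    two of the characters, is a shorter relation. *)
Lemma characters_independent (K : fieldType) (T : zmodType) (I : eqType)
    (D : T -> Prop) (c : I -> K) (chi : I -> T -> K) (s : seq I) :
  uniq s -> D 0 -> (forall x y, D x -> D y -> D (x + y)) ->
  (forall i x y, chi i (x + y) = chi i x * chi i y) ->
  (forall i, chi i 0 = 1) ->
  (forall i j, i \in s -> j \in s -> i != j ->
     exists2 y, D y & chi i y != chi j y) ->
  (forall y, D y -> \sum_(i <- s) c i * chi i y = 0) ->
  forall i, i \in s -> c i = 0.
Proof.
move=> us D0 DD chiD chi0.
elim: s us c => [//|i0 s IHs] /= /andP[i0s us] c sep H.
have cs i : i \in s -> c i = 0.
  move=> is_; have [||y Dy nchi] := sep i i0 _ (mem_head _ _).
  - by rewrite inE is_ orbT.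
  - by apply: contraNneq i0s => <-.
  suff /eqP : c i * (chi i y - chi i0 y) = 0.
    by rewrite mulf_eq0 subr_eq0 (negPf nchi) orbF => /eqP.
  apply: (IHs us (fun i => c i * (chi i y - chi i0 y))) => //.
  - by move=> j k js ks; apply: sep; rewrite inE ?js ?ks orbT.
  move=> x Dx; have := H (x + y) (DD _ _ Dx Dy); have := H x Dx.
  rewrite !big_cons => /eqP; rewrite addr_eq0 => /eqP Hx Hxy.
  transitivity (\sum_(j <- s) c j * chi j (x + y) -
                \sum_(j <- s) c j * chi j x * chi i0 y).
    by rewrite -sumrB; apply: eq_bigr => j _; rewrite chiD; ring.
  rewrite -mulr_suml -[\sum_(j <- s) c j * chi j x]opprK -Hx -[RHS]Hxy chiD.
  by ring.
move=> i; rewrite inE => /predU1P[->|]; last exact: cs.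
have := H 0 D0; rewrite big_cons big1_seq => [|j /andP[_ js]]; last first.
  by rewrite cs ?mul0r.
by rewrite addr0 chi0 mulr1.
Qed.

Variable R : realType.

Lemma cexpD (z w : R[i]) : cexp (z + w) = cexp z * cexp w.
Proof.
case: z w => [a b] [c d]; rewrite /cexp /= expRD cosD sinD.
by apply/eqP; rewrite eq_complex /=; apply/andP; split; apply/eqP; ring.
Qed.

Lemma cexp_real (r : R) : cexp r%:C = (expR r)%:C.
Proof. by rewrite /cexp /= cos0 sin0 mulr1. Qed.

Lemma cexp0 : cexp (0 : R[i]) = 1.
Proof. by rewrite (cexp_real 0) expR0. Qed.

Lemma cexp_neq0 (z : R[i]) : cexp z != 0.
Proof.
apply/eqP => z0; have := cexpD z (- z).
by rewrite z0 mul0r subrr cexp0 => /eqP; rewrite oner_eq0.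
Qed.

Definition pi_i : R[i] := 0 +i* pi.

Lemma cexp_pi : cexp pi_i = -1.
Proof.
rewrite /cexp /= expR0 cospi sinpi mul1r.
by apply/eqP; rewrite eq_complex /= oppr0 !eqxx.
Qed.

End Exponentials.

(** * Pairings and reflections *)

Section Pairing.
Variables (K : comNzRingType) (n : nat) (G : 'M[K]_n).

Lemma bilDl u v w : bil G (u + v) w = bil G u w + bil G v w.
Proof. by rewrite /bil !mulmxDl mxE. Qed.

Lemma bilDr u v w : bil G w (u + v) = bil G w u + bil G w v.
Proof. by rewrite /bil linearD /= mulmxDr mxE. Qed.

Lemma bilZl c u w : bil G (c *: u) w = c * bil G u w.
Proof. by rewrite /bil -!scalemxAl mxE. Qed.

Lemma bilZr c u w : bil G w (c *: u) = c * bil G w u.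
Proof. by rewrite /bil linearZ /= -scalemxAr mxE. Qed.

Lemma bilNl u w : bil G (- u) w = - bil G u w.
Proof. by rewrite -scaleN1r bilZl mulN1r. Qed.

Lemma bilNr u w : bil G w (- u) = - bil G w u.
Proof. by rewrite -scaleN1r bilZr mulN1r. Qed.

Lemma bil0l w : bil G 0 w = 0.
Proof. by rewrite -(scale0r 0) bilZl mul0r. Qed.

Lemma bil_sym u v : G^T = G -> bil G u v = bil G v u.
Proof.
move=> GT; rewrite /bil -[in LHS](trmxK (u *m G *m v^T)) mxE.
by rewrite !trmx_mul trmxK GT mulmxA.
Qed.

End Pairing.

Section RootSystem.
Variables (R : realType) (n : nat) (G : 'M[R]_n) (Phi : {fset 'rV[R]_n}).
Local Notation V := 'rV[R]_n.
Local Notation VC := 'rV[R[i]]_n.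
Local Notation ip := (bil G).
Local Notation pc a x := (pairC G (cplx a) x).
Local Notation refl := (reflection G).

Hypotheses (hG : scalar_product G) (hPhi : root_system G Phi)
  (hred : reduced_root_system Phi).

Lemma ipC u v : ip u v = ip v u.
Proof. by apply: bil_sym; case: hG. Qed.

Lemma ip_gt0 v : v != 0 -> 0 < ip v v.
Proof. by case: hG => _; apply. Qed.

Lemma cplxD (u v : V) : cplx (u + v) = cplx u + cplx v.
Proof. by rewrite /cplx map_mxD. Qed.

Lemma cplxN (u : V) : cplx (- u) = - cplx u.
Proof. by rewrite /cplx map_mxN. Qed.

Lemma cplxZ c (u : V) : cplx (c *: u) = c%:C *: cplx u.
Proof. by rewrite /cplx map_mxZ. Qed.

Lemma pairC_cplx (u v : V) : pc u (cplx v) = (ip u v)%:C.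
Proof. by rewrite /pairC /bil /cplx map_trmx -!map_mxM mxE. Qed.

Lemma pairCDl u v x : pc (u + v) x = pc u x + pc v x.
Proof. by rewrite cplxD /pairC bilDl. Qed.

Lemma pairCNl u x : pc (- u) x = - pc u x.
Proof. by rewrite cplxN /pairC bilNl. Qed.

Lemma pairCZl c u x : pc (c *: u) x = c%:C * pc u x.
Proof. by rewrite cplxZ /pairC bilZl. Qed.

Lemma pairCDr u x y : pc u (x + y) = pc u x + pc u y.
Proof. by rewrite /pairC bilDr. Qed.

Lemma pairCNr u x : pc u (- x) = - pc u x.
Proof. by rewrite /pairC bilNr. Qed.

Lemma pairCZr c u x : pc u (c *: x) = c * pc u x.
Proof. by rewrite /pairC bilZr. Qed.

Lemma root_neq0 a : a \in Phi -> a != 0.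
Proof. by move=> aP; case: hPhi => P0 _ _ _; apply: contraNneq P0 => <-. Qed.

Lemma ip_root_neq0 a : a \in Phi -> ip a a != 0.
Proof. by move=> aP; rewrite gt_eqF// ip_gt0// root_neq0. Qed.

Lemma ip_coroot a : a \in Phi -> ip a (coroot G a) = 2.
Proof. by move=> aP; rewrite /coroot bilZr divfK// ip_root_neq0. Qed.

Lemma corootK a : a \in Phi -> coroot G (coroot G a) = a.
Proof.
move=> aP; rewrite {1}/coroot {1 2}/coroot bilZl ip_coroot//.
rewrite {1}/coroot scalerA -[RHS]scale1r; congr (_ *: _).
by have := ip_root_neq0 aP; move: (ip a a) => t t0; field; rewrite t0 ?pnatr_eq0.
Qed.

Lemma corootN a : coroot G (- a) = - coroot G a.
Proof. by rewrite /coroot bilNl bilNr opprK scalerN. Qed.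

Lemma reflection_root a b : a \in Phi -> b \in Phi -> refl a b \in Phi.
Proof. by case: hPhi => _ _ + _; apply. Qed.

Lemma ip_root_coroot_int a b :
  a \in Phi -> b \in Phi -> ip b (coroot G a) \is a Num.int.
Proof. by case: hPhi => _ _ _; apply. Qed.

Lemma reflectionxx a : a \in Phi -> refl a a = - a.
Proof.
move=> aP; rewrite /reflection ip_coroot// scaler_nat mulr2n opprD addrA.
by rewrite subrr sub0r.
Qed.

Lemma rootN a : a \in Phi -> - a \in Phi.
Proof. by move=> aP; rewrite -reflectionxx// reflection_root. Qed.

Lemma reflectionN a v : refl (- a) v = refl a v.
Proof. by rewrite /reflection corootN bilNr scalerN scaleNr opprK. Qed.

Lemma reflectionK a : a \in Phi -> involutive (refl a).
Proof.
move=> aP v; rewrite /reflection bilDl bilNl bilZl ip_coroot//.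
move: (ip _ _) => t; rewrite -addrA -opprD -scalerDl.
by rewrite (_ : t + _ = 0) ?scale0r ?subr0//; ring.
Qed.

Lemma ip_reflection_l a u v : ip (refl a u) v = ip u (refl a v).
Proof.
rewrite /reflection bilDl bilDr bilNl bilNr bilZl bilZr /coroot !bilZr.
by rewrite (ipC v a); ring.
Qed.

Lemma ip_reflection a u v : a \in Phi -> ip (refl a u) (refl a v) = ip u v.
Proof. by move=> aP; rewrite ip_reflection_l reflectionK. Qed.

Lemma reflection_coroot a b :
  a \in Phi -> refl a (coroot G b) = coroot G (refl a b).
Proof.
move=> aP; rewrite {2}/coroot ip_reflection// /reflection /coroot.
by rewrite scalerBr bilZl scalerA.
Qed.

Lemma reflection_corootxx a : a \in Phi -> refl a (coroot G a) = - coroot G a.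
Proof. by move=> aP; rewrite reflection_coroot// reflectionxx// corootN. Qed.

(** The complexified reflection, written with the root on the left of the
    pairing so that it involves the bilinear extension only once. *)
Definition creflection (a : V) (x : VC) : VC := x - pc a x *: cplx (coroot G a).

Lemma creflectionD a x y : creflection a (x + y) = creflection a x + creflection a y.
Proof. by rewrite /creflection pairCDr scalerDl opprD addrACA. Qed.

Lemma creflection_cplx a v : creflection a (cplx v) = cplx (refl a v).
Proof.
rewrite /creflection /reflection pairC_cplx cplxD cplxN !cplxZ.
rewrite scalerA -!rmorphM /= (ipC a v) /coroot bilZr.
by congr (_ - (_)%:C *: _); rewrite mulrC.
Qed.

Lemma pairC_creflection a b x : pc b (creflection a x) = pc (refl a b) x.
Proof.
rewrite /creflection /reflection pairCDr pairCNr pairCZr pairC_cplx.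
by rewrite pairCDl pairCNl pairCZl mulrC.
Qed.

Lemma creflectionK a : a \in Phi -> involutive (creflection a).
Proof.
move=> aP x; rewrite {1}/creflection pairC_creflection reflectionxx// pairCNl.
by rewrite scaleNr opprK /creflection subrK.
Qed.

Lemma creflectionN a x : creflection (- a) x = creflection a x.
Proof. by rewrite /creflection pairCNl corootN cplxN scaleNr scalerN opprK. Qed.

(** The component of b orthogonal to a; it is nonzero because b is not
    proportional to a in a reduced system. *)
Lemma orthogonal_direction a b : a \in Phi -> b \in Phi -> b != a -> b != - a ->
  exists2 v : V, ip a v = 0 & ip b v != 0.
Proof.
move=> aP bP ba bNa; have aa0 := ip_root_neq0 aP.
pose v := b - (ip b a / ip a a) *: a.
have av : ip a v = 0.
  by rewrite /v bilDr bilNr bilZr divfK// (ipC a b) subrr.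
exists v => //; have -> : ip b v = ip v v.
  by rewrite {2}/v bilDl bilNl bilZl av mulr0 subr0.
rewrite gt_eqF// ip_gt0// subr_eq0; apply: contraNneq ba => bE.
rewrite bE in bP *.
by have [->|c1] := hred aP bP; rewrite ?scale1r//; rewrite bE c1 scaleN1r eqxx in bNa.
Qed.

Lemma perm_root_reflection a : a \in Phi -> perm_eq (map (refl a) Phi) Phi.
Proof.
move=> aP; apply: uniq_perm.
- by rewrite map_inj_uniq ?fset_uniq//; exact: (can_inj (reflectionK aP)).
- exact: fset_uniq.
move=> b; apply/mapP/idP => [[c cP ->]|bP]; first exact: reflection_root.
by exists (refl a b); rewrite ?reflection_root ?reflectionK.
Qed.

Lemma weight_reflection a v : a \in Phi ->
  weight_lattice G Phi v -> weight_lattice G Phi (refl a v).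
Proof.
move=> aP Pv b bP; rewrite /reflection bilDl bilNl bilZl.
by rewrite rpredB ?rpredM ?Pv// ip_root_coroot_int.
Qed.

Lemma weightD u v : weight_lattice G Phi u -> weight_lattice G Phi v ->
  weight_lattice G Phi (u + v).
Proof. by move=> Pu Pv b bP; rewrite bilDl rpredD ?Pu ?Pv. Qed.

Lemma weightN u : weight_lattice G Phi u -> weight_lattice G Phi (- u).
Proof. by move=> Pu b bP; rewrite bilNl rpredN Pu. Qed.

Lemma weight0 : weight_lattice G Phi 0.
Proof. by move=> b bP; rewrite bil0l. Qed.

Lemma weight_root a : a \in Phi -> weight_lattice G Phi a.
Proof. by move=> aP b bP; exact: ip_root_coroot_int. Qed.

Lemma weightZ (k : int) u : weight_lattice G Phi u -> weight_lattice G Phi (k%:~R *: u).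
Proof. by move=> Pu b bP; rewrite bilZl rpredM ?Pu// intr_int. Qed.

(** * Weight polynomials *)

Variable logq : R[i].
Local Notation crefl := creflection.
Local Notation qp := (qpow logq).
Local Notation wpoly := (weight_polynomial G Phi logq).

Lemma qpowD z w : qp (z + w) = qp z * qp w.
Proof. by rewrite /qpow mulrDl cexpD. Qed.

Lemma qpow0 : qp 0 = 1.
Proof. by rewrite /qpow mul0r cexp0. Qed.

Lemma qpow_neq0 z : qp z != 0.
Proof. exact: cexp_neq0. Qed.

Lemma qpowN z : qp (- z) = (qp z)^-1.
Proof.
by apply: (mulfI (qpow_neq0 z)); rewrite -qpowD subrr qpow0 mulfV// qpow_neq0.
Qed.

Lemma qpowMn z k : qp (z * k%:R) = qp z ^+ k.
Proof.
elim: k => [|k IHk]; first by rewrite mulr0 qpow0.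
by rewrite -natr1 mulrDr mulr1 qpowD IHk exprSr.
Qed.

Lemma qpowM_int z (t : R) : t \is a Num.int -> qp z = 1 -> qp (z * t%:C) = 1.
Proof.
move=> /intrP[[k|k] ->] z1; first by rewrite rmorph_int qpowMn z1 expr1n.
by rewrite rmorph_int NegzE mulrNz mulrN qpowN qpowMn z1 expr1n invr1.
Qed.

(** Sealed, so that two values are compared through their arguments and not by
    unfolding the exponential. *)
Fact character_key : unit. Proof. exact: tt. Qed.
Definition character : V -> VC -> R[i] :=
  locked_with character_key (fun a x => qp (2 * pc a x)).
Local Notation chi := character.

Lemma characterE a x : chi a x = qp (2 * pc a x).
Proof. by rewrite /character unlock. Qed.

Lemma characterDl a b x : chi (a + b) x = chi a x * chi b x.
Proof. by rewrite !characterE pairCDl mulrDr qpowD. Qed.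

Lemma characterDr a x y : chi a (x + y) = chi a x * chi a y.
Proof. by rewrite !characterE pairCDr mulrDr qpowD. Qed.

Lemma character_neq0 a x : chi a x != 0.
Proof. by rewrite characterE qpow_neq0. Qed.

Lemma characterN a x : chi (- a) x = (chi a x)^-1.
Proof. by rewrite !characterE pairCNl mulrN qpowN. Qed.

Lemma character0l x : chi 0 x = 1.
Proof. by rewrite !characterE -(scale0r 0) pairCZl mul0r mulr0 qpow0. Qed.

Lemma character0r a : chi a 0 = 1.
Proof. by rewrite !characterE -(scale0r 0) pairCZr mul0r mulr0 qpow0. Qed.

Lemma character_creflection a b x : chi b (crefl a x) = chi (refl a b) x.
Proof. by rewrite !characterE pairC_creflection. Qed.

(** Lists of monomials with repetitions make the closure properties immediate:
    a sum is a concatenation and a product is a list of all pairs. *)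
Lemma weight_polynomialP (f : VC -> R[i]) : wpoly f <->
  exists2 s : seq (R[i] * V), (forall p, p \in s -> weight_lattice G Phi p.2) &
    forall x, f x = \sum_(p <- s) p.1 * chi p.2 x.
Proof.
split=> [[S [c [SP fE]]]|[s sP fE]].
  exists [seq (c v, v) | v <- S]; first by move=> p /mapP[v vS ->]; exact: SP.
  by move=> x; rewrite fE big_map; apply: eq_bigr => v _; rewrite characterE.
exists (seq_fset tt (map snd s)), (fun v => \sum_(p <- s | p.2 == v) p.1).
split=> [v|x]; first by rewrite seq_fsetE => /mapP[p ps ->]; exact: sP.
rewrite fE.
under [RHS]eq_bigr => v _ do rewrite -characterE.
under [RHS]eq_bigr => v _ do rewrite mulr_suml.
rewrite (exchange_big_dep predT)//=; apply: eq_big_seq => p ps.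
rewrite (eq_bigl (pred1 p.2)) => [|v]; last by rewrite /= eq_sym.
rewrite -big_filter filter_pred1_uniq ?big_seq1//; first exact: sort_keys_uniq.
rewrite sort_keysE.
by apply/mapP; exists p.
Qed.

Lemma wpoly_ext f g : (forall x, f x = g x) -> wpoly f -> wpoly g.
Proof. by move=> fg [S [c [SP fE]]]; exists S, c; split=> // x; rewrite -fg. Qed.

Lemma wpoly_character v : weight_lattice G Phi v -> wpoly (chi v).
Proof.
move=> vP; apply/weight_polynomialP; exists [:: (1, v)].
  by move=> p; rewrite inE => /eqP ->.
by move=> x; rewrite big_seq1 mul1r.
Qed.

Lemma wpolyD f g : wpoly f -> wpoly g -> wpoly (fun x => f x + g x).
Proof.
move=> /weight_polynomialP[s sP fE] /weight_polynomialP[t tP gE].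
apply/weight_polynomialP; exists (s ++ t).
  by move=> p; rewrite mem_cat => /orP[/sP|/tP].
by move=> x; rewrite big_cat fE gE.
Qed.

Lemma wpolyM f g : wpoly f -> wpoly g -> wpoly (fun x => f x * g x).
Proof.
move=> /weight_polynomialP[s sP fE] /weight_polynomialP[t tP gE].
apply/weight_polynomialP.
exists [seq (p.1 * r.1, p.2 + r.2) | p <- s, r <- t].
  by move=> _ /allpairsP[[p r] /= [ps rt ->]]; exact: weightD (sP _ ps) (tP _ rt).
move=> x; rewrite big_allpairs_dep fE gE mulr_suml; apply: eq_bigr => p _.
by rewrite mulr_sumr; apply: eq_bigr => r _; rewrite characterDl mulrACA.
Qed.

Lemma wpoly_cst c : wpoly (fun=> c).
Proof.
apply/weight_polynomialP; exists [:: (c, 0)].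
  by move=> p; rewrite inE => /eqP ->; exact: weight0.
by move=> x; rewrite big_seq1 character0l mulr1.
Qed.

Lemma wpolyZ c f : wpoly f -> wpoly (fun x => c * f x).
Proof. by move=> fP; exact: wpolyM (wpoly_cst c) fP. Qed.

Lemma wpolyB f g : wpoly f -> wpoly g -> wpoly (fun x => f x - g x).
Proof.
move=> fP gP; apply: wpoly_ext (wpolyD fP (wpolyZ (-1) gP)) => x.
by rewrite mulN1r.
Qed.

Lemma wpoly_sum (I : eqType) (r : seq I) (P : pred I) (F : I -> VC -> R[i]) :
  (forall i, i \in r -> P i -> wpoly (F i)) ->
  wpoly (fun x => \sum_(i <- r | P i) F i x).
Proof.
elim: r => [_|i r IHr H].
  by apply: wpoly_ext (wpoly_cst 0) => x; rewrite big_nil.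
have {}IHr : wpoly (fun x => \sum_(j <- r | P j) F j x).
  by apply: IHr => j jr; apply: H; rewrite inE jr orbT.
case Pi : (P i).
  apply: wpoly_ext (wpolyD (H i (mem_head _ _) Pi) IHr) => x.
  by rewrite big_cons Pi.
by apply: wpoly_ext IHr => x; rewrite big_cons Pi.
Qed.

Lemma wpoly_prod (I : eqType) (r : seq I) (P : pred I) (F : I -> VC -> R[i]) :
  (forall i, i \in r -> P i -> wpoly (F i)) ->
  wpoly (fun x => \prod_(i <- r | P i) F i x).
Proof.
elim: r => [_|i r IHr H].
  by apply: wpoly_ext (wpoly_cst 1) => x; rewrite big_nil.
have {}IHr : wpoly (fun x => \prod_(j <- r | P j) F j x).
  by apply: IHr => j jr; apply: H; rewrite inE jr orbT.
case Pi : (P i).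
  apply: wpoly_ext (wpolyM (H i (mem_head _ _) Pi) IHr) => x.
  by rewrite big_cons Pi.
by apply: wpoly_ext IHr => x; rewrite big_cons Pi.
Qed.

Lemma wpoly_shift f (y : VC) : wpoly f -> wpoly (fun x => f (x + y)).
Proof.
move=> /weight_polynomialP[s sP fE].
apply/weight_polynomialP; exists [seq (p.1 * chi p.2 y, p.2) | p <- s].
  by move=> _ /mapP[p ps ->] /=; exact: (sP _ ps).
move=> x; rewrite fE big_map; apply: eq_bigr => p _.
by rewrite characterDr /= mulrA mulrAC.
Qed.

Lemma wpoly_creflection a f : a \in Phi -> wpoly f -> wpoly (fun x => f (crefl a x)).
Proof.
move=> aP /weight_polynomialP[s sP fE].
apply/weight_polynomialP; exists [seq (p.1, refl a p.2) | p <- s].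
  by move=> _ /mapP[p ps ->]; apply: weight_reflection => //; exact: sP.
by move=> x; rewrite fE big_map; apply: eq_bigr => p _; rewrite character_creflection.
Qed.

(** Weights pair integrally with coroots, so translations of half a period of
    q^z along a coroot are periods of all weight polynomials. *)
Lemma wpoly_periodic f a c x : wpoly f -> a \in Phi -> qp (2 * c) = 1 ->
  f (x + c *: cplx (coroot G a)) = f x.
Proof.
move=> /weight_polynomialP[s sP fE] aP c1.
rewrite !fE; apply: eq_big_seq => p ps.
rewrite characterDr [X in _ * (_ * X)](_ : _ = 1) ?mulr1//.
by rewrite characterE pairCZr mulrA pairC_cplx qpowM_int// sP.
Qed.

Hypothesis q_generic : forall k, (0 < k)%N -> qp k%:R != 1.

Lemma logq_neq0 : logq != 0.
Proof.
by apply: contra_neq (q_generic (ltn0Sn 0)) => l0; rewrite /qpow l0 mulr0 cexp0.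
Qed.

(** Along a real direction divided by log q every character is a geometric
    progression with a positive real ratio. *)
Definition line (x : VC) (v : V) (k : nat) : VC := x + (k%:R / logq) *: cplx v.

Lemma character_line a x v k :
  chi a (line x v k) = chi a x * ((expR (2 * ip a v))%:C) ^+ k.
Proof.
rewrite /line characterDr; congr (_ * _).
rewrite characterE /qpow pairCZr pairC_cplx -cexp_real.
rewrite (_ : _ * _ * logq = (2 * ip a v)%:C * k%:R); last first.
  by rewrite rmorphM /= rmorph_nat; have := logq_neq0; move: (logq) => l l0; field.
elim: k => [|k IHk]; first by rewrite mulr0 cexp0.
by rewrite -(natr1 k) mulrDr mulr1 cexpD IHk exprSr.
Qed.

(** The zero set of [wall a g] is the union of the hyperplanes on which (a, x)
    equals g up to half a period of q^z; [wall] is sealed like [character]. *)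
Fact wall_key : unit. Proof. exact: tt. Qed.
Definition wall : V -> int -> VC -> R[i] :=
  locked_with wall_key (fun a g x => chi a x - qp (2 * g%:~R)).

Lemma wallE a g x : wall a g x = chi a x - qp (2 * g%:~R).
Proof. by rewrite /wall unlock. Qed.

Lemma wpoly_wall a g : a \in Phi -> wpoly (wall a g).
Proof.
move=> aP; apply: (@wpoly_ext (fun x => chi a x - qp (2 * g%:~R))) => [x|].
  by rewrite wallE.
by apply: wpolyB; [exact/wpoly_character/(weight_root)|exact: wpoly_cst].
Qed.

(** On the line the wall is a geometric progression of ratio different from 1
    minus a constant, hence it vanishes at one point at most, and the values of
    f at the integer points form an exponential sum that is eventually zero. *)
Lemma wall_cancel_line f x v b g : wpoly f -> ip b v != 0 ->
  (forall k, wall b g (line x v k) * f (line x v k) = 0) -> f x = 0.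
Proof.
move=> /weight_polynomialP[s sP fE] bv0 H.
pose e := (expR (2 * ip b v))%:C : R[i].
have expr_inj (k l : nat) : e ^+ k = e ^+ l -> k = l.
  rewrite -!rmorphXn => /(fmorph_inj (real_complex R)).
  rewrite -!expRM_natr => /expR_inj /eqP.
  rewrite -subr_eq0 -mulrBr mulf_eq0 mulf_eq0 pnatr_eq0 (negPf bv0) /= subr_eq0.
  by rewrite eqr_nat => /eqP.
have [K HK] : exists K, forall k, (K <= k)%N -> wall b g (line x v k) != 0.
  have [[k0 k0E]|noz] := pselect (exists k0, wall b g (line x v k0) = 0); last first.
    by exists 0%N => k _; apply/eqP => wk; apply: noz; exists k.
  exists k0.+1 => k k0k; apply/eqP => wk; suff kk0 : k = k0 by rewrite kk0 ltnn in k0k.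
  apply: expr_inj; apply: (mulfI (character_neq0 b x)).
  apply: (addIr (- qp (2 * g%:~R))).
  by rewrite /e -!character_line -!wallE wk k0E.
pose t := [seq (p.1 * chi p.2 x, (expR (2 * ip p.2 v))%:C) | p <- s] : seq (R[i] * R[i]).
have tE k : \sum_(p <- t) p.1 * p.2 ^+ k = f (line x v k).
  by rewrite fE big_map; apply: eq_bigr => p _; rewrite character_line mulrA.
have -> : f x = f (line x v 0) by rewrite /line mul0r scale0r addr0.
rewrite -tE; apply: (@exponential_sum_eq0 _ t K) => [_ /mapP[p _ ->] /=|k /HK wk].
  by rewrite (fmorph_eq0 (real_complex R)) gt_eqF// expR_gt0.
by rewrite tE; apply/eqP; have /eqP := H k; rewrite mulf_eq0 (negPf wk).
Qed.

Lemma wall_cancel f b g : b \in Phi -> wpoly f ->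
  (forall x, wall b g x * f x = 0) -> forall x, f x = 0.
Proof.
move=> bP fP H x; apply: (@wall_cancel_line f x b b g) => //.
exact: ip_root_neq0.
Qed.

(** * Divisibility by a wall *)

Definition divides (D X : VC -> R[i]) : Prop :=
  exists2 K : VC -> R[i], wpoly K & forall x, X x = D x * K x.

Lemma divides_ext D X Y : (forall x, X x = Y x) -> divides D X -> divides D Y.
Proof. by move=> XY [K KP XE]; exists K => // x; rewrite -XY. Qed.

Lemma divides0 D : divides D (fun=> 0).
Proof. by exists (fun=> 0) => [|x]; rewrite ?mulr0//; exact: wpoly_cst. Qed.

Lemma dividesD D X Y : divides D X -> divides D Y -> divides D (fun x => X x + Y x).
Proof.
move=> [K KP XE] [L LP YE]; exists (fun x => K x + L x); first exact: wpolyD.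
by move=> x; rewrite mulrDr XE YE.
Qed.

Lemma divides_sum (I : eqType) (r : seq I) D (X : I -> VC -> R[i]) :
  (forall i, i \in r -> divides D (X i)) ->
  divides D (fun x => \sum_(i <- r) X i x).
Proof.
elim: r => [_|i r IHr H].
  by apply: divides_ext (divides0 D) => x; rewrite big_nil.
apply: divides_ext (dividesD (H i (mem_head _ _)) (IHr _)) => [x|j jr].
  by rewrite big_cons.
by apply: H; rewrite inE jr orbT.
Qed.

Lemma dividesMl D X Y : divides D X -> wpoly Y -> divides D (fun x => Y x * X x).
Proof.
move=> [K KP XE] YP; exists (fun x => Y x * K x); first exact: wpolyM.
by move=> x; rewrite XE mulrCA.
Qed.

Lemma dividesM D E X Y : divides D X -> divides E Y ->
  divides (fun x => D x * E x) (fun x => X x * Y x).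
Proof.
move=> [K KP XE] [L LP YE]; exists (fun x => K x * L x); first exact: wpolyM.
by move=> x; rewrite XE YE mulrACA.
Qed.

Lemma divides_refl D : divides D D.
Proof. by exists (fun=> 1) => [|x]; rewrite ?mulr1//; exact: wpoly_cst. Qed.

Lemma collect_coefficients (s : seq (R[i] * V)) (t : seq V) x :
  uniq t -> {subset map snd s <= t} ->
  \sum_(v <- t) (\sum_(p <- s | p.2 == v) p.1) * chi v x =
  \sum_(p <- s) p.1 * chi p.2 x.
Proof.
move=> ut st; under eq_bigr => v _ do rewrite mulr_suml.
rewrite (exchange_big_dep predT)//=; apply: eq_big_seq => p ps.
rewrite (eq_bigl (pred1 p.2)) => [|v]; last by rewrite /= eq_sym.
by rewrite -big_filter filter_pred1_uniq ?big_seq1//; apply/st/mapP; exists p.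
Qed.

Lemma divides_characterZ a g v (k : nat) : a \in Phi -> weight_lattice G Phi v ->
  divides (wall a g) (fun x => chi (v + k%:R *: a) x - qp (2 * g%:~R) ^+ k * chi v x).
Proof.
move=> aP vP; elim: k => [|k IHk].
  by apply: divides_ext (divides0 _) => x; rewrite scale0r addr0 expr0 mul1r subrr.
have vkP : weight_lattice G Phi (v + k%:R *: a).
  by apply: weightD => //; exact: (weightZ (k : int) (weight_root aP)).
have H1 := dividesMl (divides_refl (wall a g)) (wpoly_character vkP).
have H2 := dividesMl IHk (wpoly_cst (qp (2 * g%:~R))).
apply: divides_ext (dividesD H1 H2) => x.
rewrite wallE -(natr1 k) scalerDl scale1r addrA (characterDl (v + _)) exprS.
move: (chi _ x) (chi a x) (qp _) (chi v x) => p r u w.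
by ring.
Qed.

(** Euclidean division of the pairing with the coroot by (a, a^vee) = 2. *)
Lemma weight_reduce a v : a \in Phi -> weight_lattice G Phi v ->
  exists w, [/\ weight_lattice G Phi w,
    ip w (coroot G a) = 0 \/ ip w (coroot G a) = 1 &
    exists k : nat, v = w + k%:R *: a \/ w = v + k%:R *: a].
Proof.
move=> aP vP; have /intrP[z zE] := vP a aP.
have [k [b zkb]] : exists (k : int) (b : bool), z = k * 2 + (b : nat) :> int.
  exists (z %/ 2)%Z, ((z %% 2)%Z == 1); rewrite {1}(divz_eq z 2); congr (_ + _).
  have := modz_ge0 z (isT : 2 != 0 :> int); have := ltz_pmod z (isT : 0 < 2 :> int).
  by case: (z %% 2)%Z => [[|[|?]]|?].
have {}zE : ip v (coroot G a) = k%:~R * 2 + b%:R by rewrite zE zkb rmorphD rmorphM.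
exists (v + (- k)%:~R *: a); split.
- by apply: weightD => //; exact/weightZ/weight_root.
- rewrite bilDl bilZl ip_coroot// zE mulrNz mulNr addrAC subrr add0r.
  by case: b {zkb zE}; [right|left].
case: k {zE zkb} => k.
  by exists k; left; rewrite mulrNz scaleNr subrK.
by exists k.+1; right; rewrite NegzE opprK.
Qed.

Lemma character_reduce a g v : a \in Phi -> weight_lattice G Phi v ->
  exists w d, [/\ weight_lattice G Phi w,
    ip w (coroot G a) = 0 \/ ip w (coroot G a) = 1 &
    divides (wall a g) (fun x => chi v x - d * chi w x)].
Proof.
move=> aP vP; have [w [wP w01 [k vw]]] := weight_reduce aP vP.
case: vw => [->|wE].
  by exists w, (qp (2 * g%:~R) ^+ k); split=> //; exact: divides_characterZ.
exists w, (qp (2 * g%:~R) ^- k); split=> //.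
have H := divides_characterZ g k aP vP; rewrite -wE in H.
apply: divides_ext (dividesMl H (wpoly_cst (- qp (2 * g%:~R) ^- k))) => x.
have := qpow_neq0 (2 * g%:~R); move: (chi w x) (qp _) (chi v x) => p r u r0.
by rewrite mulNr mulrBr opprB mulrA mulVf ?mul1r// expf_neq0.
Qed.

Lemma wpoly_reduce a g f : a \in Phi -> wpoly f ->
  exists s : seq (R[i] * V), 
   [/\ forall p, p \in s -> weight_lattice G Phi p.2 /\
     (ip p.2 (coroot G a) = 0 \/ ip p.2 (coroot G a) = 1) &
    divides (wall a g) (fun x => f x - \sum_(p <- s) p.1 * chi p.2 x)].
Proof.
move=> aP /weight_polynomialP[s sP fE].
elim: s f sP fE => [|p s IHs] f sP fE.
  exists [::]; split=> //; apply: divides_ext (divides0 _) => x.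
  by rewrite fE !big_nil subrr.
have [|t [tP tD]] := IHs (fun x => \sum_(r <- s) r.1 * chi r.2 x) _ (fun=> erefl).
  by move=> r rs; apply: sP; rewrite inE rs orbT.
have [w [d [wP w01 wD]]] := character_reduce g aP (sP _ (mem_head _ _)).
exists ((p.1 * d, w) :: t); split=> [r|].
  by rewrite inE => /predU1P[->|/tP].
apply: divides_ext (dividesD (dividesMl wD (wpoly_cst p.1)) tD) => x.
by rewrite fE !big_cons /= mulrBr mulrA opprD addrACA.
Qed.

(** On real multiples of pi i / (2 log q) the characters take the values of the
    character exp (pi i t) of the reals. *)
Lemma character_pi v u :
  chi v ((pi_i R / (2 * logq)) *: cplx u) = cexp (pi_i R * (ip v u)%:C).
Proof.
rewrite characterE /qpow pairCZr pairC_cplx; congr cexp.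
by have := logq_neq0; move: (pi_i R) (logq) (_%:C) => t l w l0; field.
Qed.

(** Weights whose pairings with the coroot of a differ by at most one are
    separated by the points where the character of a is trivial. *)
Lemma reduced_weights_separated a v w : a \in Phi ->
  ip v (coroot G a) = 0 \/ ip v (coroot G a) = 1 ->
  ip w (coroot G a) = 0 \/ ip w (coroot G a) = 1 -> v != w ->
  exists2 y, chi a y = 1 & chi v y != chi w y.
Proof.
move=> aP v01 w01 vw; pose d := v - w.
have [u [ua ud]] : exists u, cexp (pi_i R * (ip a u)%:C) = 1 /\
    cexp (pi_i R * (ip d u)%:C) = -1.
  have pi2 : cexp (pi_i R * 2) = 1.
    by rewrite mulr_natr mulr2n cexpD cexp_pi mulrNN mulr1.
  have piN : cexp (pi_i R * (- 1)) = -1.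
    have := cexpD (pi_i R * (- 1)) (pi_i R * 2); rewrite pi2 mulr1 => <-.
    transitivity (cexp (pi_i R)); last exact: cexp_pi.
    by congr cexp; rewrite mulrN1 mulr_natr mulr2n addKr.
  (* If v - w is orthogonal to a, move along v - w; else along the coroot. *)
  have [d0|d0] := eqVneq (ip d (coroot G a)) 0.
    exists ((ip d d)^-1 *: d); rewrite !bilZr.
    have dd0 : ip d d != 0 by rewrite gt_eqF// ip_gt0// subr_eq0.
    rewrite mulVf// mulr1 cexp_pi; split=> //.
    suff -> : ip a d = 0 by rewrite mulr0 mulr0 cexp0.
    move: d0; rewrite /coroot bilZr ipC => /eqP; rewrite mulf_eq0.
    rewrite mulf_eq0 invr_eq0 pnatr_eq0 (negPf (ip_root_neq0 aP)) /=.
    by move/eqP.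
  exists (coroot G a); rewrite ip_coroot//.
  rewrite rmorph_nat pi2; split=> //.
  have : ip d (coroot G a) = 1 \/ ip d (coroot G a) = -1.
    move: d0; rewrite /d bilDl bilNl.
    by case: v01 w01 => -> [] ->; rewrite ?subrr ?eqxx// ?subr0 ?sub0r; [right|left].
  by case=> ->; rewrite ?rmorphN rmorph1 ?mulr1 ?cexp_pi.
exists ((pi_i R / (2 * logq)) *: cplx u); first by rewrite character_pi.
have -> : v = d + w by rewrite subrK.
rewrite characterDl (character_pi d) ud mulN1r eq_sym -addr_eq0 -mulr2n.
by rewrite mulrn_eq0 /= character_neq0.
Qed.

(** Nullstellensatz for one wall: modulo the wall, f is a combination of weights
    whose pairings with the coroot are 0 or 1, and these are linearly
    independent as functions on the wall. *)
Lemma wall_divides a g f : a \in Phi -> wpoly f ->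
  (forall x, wall a g x = 0 -> f x = 0) -> divides (wall a g) f.
Proof.
move=> aP fP f0; have [s [sP [K KP sD]]] := wpoly_reduce g aP fP.
pose t := undup (map snd s).
pose c v := \sum_(p <- s | p.2 == v) p.1.
have sE x : \sum_(p <- s) p.1 * chi p.2 x = \sum_(v <- t) c v * chi v x.
  rewrite collect_coefficients ?undup_uniq// => v; by rewrite mem_undup.
have tP v : v \in t -> ip v (coroot G a) = 0 \/ ip v (coroot G a) = 1.
  by rewrite mem_undup => /mapP[p /sP[_ ?] ->].
(* a point of the wall, since (a, a^vee) = 2 *)
pose x0 : VC := (g%:~R / 2) *: cplx (coroot G a).
have x0E : chi a x0 = qp (2 * g%:~R).
  by rewrite characterE pairCZr pairC_cplx ip_coroot// rmorph_nat divfK ?pnatr_eq0.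
have H v : v \in t -> c v * chi v x0 = 0.
  move: v; apply: (@characters_independent _ _ _ (fun y => chi a y = 1) _ chi).
  - exact: undup_uniq.
  - exact: character0r.
  - by move=> x y x1 y1; rewrite characterDr x1 y1 mulr1.
  - by move=> v x y; rewrite characterDr.
  - exact: character0r.
  - by move=> v w /tP v01 /tP w01; exact: reduced_weights_separated.
  move=> y y1; have w0 : wall a g (x0 + y) = 0.
    by rewrite wallE characterDr y1 mulr1 x0E subrr.
  have := sD (x0 + y); rewrite f0// w0 mul0r sub0r => /eqP; rewrite oppr_eq0 => /eqP.
  by rewrite sE => {2}<-; apply: eq_bigr => v _; rewrite characterDr mulrA.
exists K => // x; rewrite -sD sE big1_seq ?subr0// => v /andP[_ /H /eqP].
by rewrite mulf_eq0 (negPf (character_neq0 _ _)) orbF => /eqP ->; rewrite mul0r.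
Qed.

(** * Coprime walls and even functions *)

Lemma wpolyX f k : wpoly f -> wpoly (fun x => f x ^+ k).
Proof.
move=> fP; elim: k => [|k IHk]; first exact: wpoly_cst.
by apply: wpoly_ext (wpolyM fP IHk) => x; rewrite exprS.
Qed.

Lemma wpolyN f : wpoly f -> wpoly (fun x => - f x).
Proof. by move=> fP; apply: wpoly_ext (wpolyZ (-1) fP) => x; rewrite mulN1r. Qed.

Lemma qpow2_int_neq1 (z : int) : z != 0 -> qp (2 * z%:~R) != 1.
Proof.
have nat_neq1 k : (0 < k)%N -> qp (2 * k%:R) != 1.
  by move=> k0; rewrite -natrM q_generic// muln_gt0.
case: z => k kz; first by rewrite nat_neq1// lt0n.
by rewrite NegzE mulrNz mulrN qpowN invr_eq1 nat_neq1.
Qed.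

Lemma wall_eq0 a g x : wall a g x = 0 <-> chi a x = qp (2 * g%:~R).
Proof. by rewrite wallE; split => [/eqP|->]; rewrite ?subrr// subr_eq0 => /eqP. Qed.

Lemma wallN a g x : wall (- a) g x = - qp (2 * g%:~R) * chi (- a) x * wall a (- g) x.
Proof.
rewrite !wallE characterN mulrNz mulrN qpowN.
have := character_neq0 a x; have := qpow_neq0 (2 * g%:~R).
by move: (chi a x) (qp _) => u r r0 u0; field; rewrite r0.
Qed.

Lemma wallN_eq0 a g x : wall (- a) g x = 0 <-> wall a (- g) x = 0.
Proof.
rewrite wallN; split=> [/eqP|->]; last by rewrite mulr0.
rewrite !mulf_eq0 oppr_eq0 (negPf (qpow_neq0 _)) (negPf (character_neq0 _ _)) /=.
by move/eqP.
Qed.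

(** Coprimality as it is used: the second wall may be cancelled from equations
    that hold on the first one. *)
Definition coprime_walls (a : V) (g : int) (b : V) (h : int) : Prop :=
  forall X : VC -> R[i], wpoly X ->
    (forall x, wall a g x = 0 -> wall b h x * X x = 0) ->
    forall x, wall a g x = 0 -> X x = 0.

(** Move along the first wall in a direction in which the second one varies. *)
Lemma coprime_walls_nonproportional a g b h :
  a \in Phi -> b \in Phi -> b != a -> b != - a -> coprime_walls a g b h.
Proof.
move=> aP bP ba bNa X XP H x ax.
have [v av bv] := orthogonal_direction aP bP ba bNa.
apply: (@wall_cancel_line X x v b h) => // k; apply: H; apply/wall_eq0.
rewrite character_line av mulr0 expR0 expr1n mulr1; exact/wall_eq0.
Qed.

Lemma coprime_walls_disjoint a g b h :
  (forall x, wall a g x = 0 -> wall b h x != 0) -> coprime_walls a g b h.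
Proof.
move=> disj X _ H x ax; have /eqP := H x ax.
by rewrite mulf_eq0 (negPf (disj x ax)) => /eqP.
Qed.

Lemma coprime_walls_same a g h : g != h -> coprime_walls a g a h.
Proof.
move=> gh; apply: coprime_walls_disjoint => x /wall_eq0 ax.
rewrite wallE ax subr_eq0; apply: contra_neq (@qpow2_int_neq1 (g - h) _) => [E|].
  by rewrite rmorphB mulrBr qpowD qpowN E mulfV// qpow_neq0.
by rewrite subr_eq0.
Qed.

Lemma coprime_walls_opp a g h : g + h != 0 -> coprime_walls a g (- a) h.
Proof.
move=> gh X XP H; apply: (@coprime_walls_same a g (- h)) => //.
  by rewrite -addr_eq0.
move=> x /H /eqP; rewrite mulf_eq0.
by move=> /orP[/eqP/wallN_eq0 ->|/eqP ->]; rewrite ?mul0r ?mulr0.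
Qed.

(** The reflection fixing pointwise the hyperplane (a, x) = g. *)
Definition affine_reflection (a : V) (g : int) (x : VC) : VC :=
  crefl a x + g%:~R *: cplx (coroot G a).
Local Notation arefl := affine_reflection.

Lemma wpoly_affine_reflection a g f :
  a \in Phi -> wpoly f -> wpoly (fun x => f (arefl a g x)).
Proof. by move=> aP fP; exact: wpoly_creflection aP (wpoly_shift _ fP). Qed.

(** On the wall the reflection moves x by a multiple of the coroot that is a
    period. *)
Lemma affine_reflection_wall a g f x y : a \in Phi -> wpoly f -> wall a g x = 0 ->
  f (arefl a g x + y) = f (x + y).
Proof.
move=> aP fP /wall_eq0 ax; rewrite /arefl /creflection.
rewrite -(wpoly_periodic (a := a) (c := g%:~R - pc a x) (x + y) fP) //.
  congr f; rewrite scalerBl -!addrA; congr (_ + _).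
  by rewrite addrCA [RHS]addrC -addrA.
by rewrite mulrBr qpowD qpowN -ax characterE mulfV// qpow_neq0.
Qed.

Lemma wall_affine_reflection a g x : a \in Phi ->
  wall a g (arefl a g x) = - qp (2 * g%:~R) * chi (- a) x * wall a g x.
Proof.
move=> aP; rewrite !wallE /arefl characterDr character_creflection reflectionxx//.
have -> : chi a (g%:~R *: cplx (coroot G a)) = qp (2 * g%:~R) ^+ 2.
  rewrite characterE pairCZr pairC_cplx ip_coroot// rmorph_nat -qpowMn.
  by congr qp; rewrite mulrA.
rewrite characterN; have := character_neq0 a x.
by move: (chi a x) (qp _) => u r u0; field.
Qed.

(** An even function vanishing on a wall vanishes there to second order: after
    one division by the odd function cutting out the wall, the quotient is odd. *)
Lemma even_divides a g f : a \in Phi -> wpoly f ->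
  (forall x, f (arefl a g x) = f x) -> (forall x, wall a g x = 0 -> f x = 0) ->
  divides (fun x => wall a g x * wall a g x) f.
Proof.
move=> aP fP even f0; have [K KP fE] := wall_divides aP fP f0.
(* the even part of the quotient K, up to a unit *)
pose L x := K x + qp (2 * g%:~R) * chi (- a) x * K (arefl a g x).
have NaP : weight_lattice G Phi (- a) by exact/weightN/weight_root.
have L0 : forall x, L x = 0.
  apply: (@wall_cancel L a g) => //.
    apply: wpolyD => //; apply: wpolyM; last exact: wpoly_affine_reflection.
    exact/wpolyZ/wpoly_character.
  move=> x; have := even x; rewrite !fE wall_affine_reflection// /L.
  move: (wall a g x) (qp _) (chi _ x) (K x) (K _) => w r u k k'.
  by rewrite mulrDr => <-; ring.
have K0 x : wall a g x = 0 -> K x = 0.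
  move=> wx; have := L0 x; rewrite /L.
  rewrite -[arefl a g x]addr0 affine_reflection_wall// addr0.
  move/wall_eq0 : wx => <-; rewrite characterN mulfV ?character_neq0// mul1r.
  by move=> /eqP; rewrite -mulr2n mulrn_eq0 /= => /eqP.
have [K' K'P KE] := wall_divides aP KP K0.
by exists K' => // x; rewrite fE KE mulrA.
Qed.

Lemma coprime_walls_divides a g b h k l X : a \in Phi -> b \in Phi ->
  coprime_walls a g b h -> wpoly X ->
  divides (fun x => wall a g x ^+ k) (fun x => wall b h x ^+ l * X x) ->
  divides (fun x => wall a g x ^+ k) X.
Proof.
move=> aP bP cop; elim: k X => [|k IHk] X XP.
  by move=> _; exists X => // x; rewrite expr0 mul1r.
move=> [K KP XE].
have X0 x : wall a g x = 0 -> X x = 0.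
  have {XE} : forall y, wall a g y = 0 -> wall b h y ^+ l * X y = 0.
    by move=> y wy; rewrite XE wy expr0n mul0r.
  elim: l x {IHk} => [|l IHl] x XE wx.
    by have := XE x wx; rewrite expr0 mul1r.
  apply: IHl => // y wy; apply: (cop (fun y => wall b h y ^+ l * X y)) => //.
    by apply: wpolyM => //; exact/wpolyX/wpoly_wall.
  by move=> z wz; rewrite mulrA -exprS XE.
have [X' X'P X'E] := wall_divides aP XP X0.
have [|K' K'P X'E'] := IHk X' X'P.
  exists K => // x; apply/eqP; rewrite -subr_eq0; apply/eqP; move: x.
  apply: (@wall_cancel _ a g) => //.
    by apply: wpolyB; apply: wpolyM => //; exact/wpolyX/wpoly_wall.
  move=> x; rewrite mulrBr !mulrA -exprS -XE X'E.
  by rewrite mulrCA mulrA subrr.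
by exists K' => // x; rewrite X'E X'E' mulrA exprS.
Qed.

(** Unique factorization for products of pairwise coprime walls. *)
Lemma divides_prod_walls (s : seq (V * int)) (e : V * int -> nat) f : uniq s ->
  (forall w, w \in s -> w.1 \in Phi) -> wpoly f ->
  (forall w, w \in s -> divides (fun x => wall w.1 w.2 x ^+ e w) f) ->
  (forall w w', w \in s -> w' \in s -> w != w' ->
     coprime_walls w.1 w.2 w'.1 w'.2) ->
  divides (fun x => \prod_(w <- s) wall w.1 w.2 x ^+ e w) f.
Proof.
elim: s f => [|w s IHs] f /=.
  by move=> _ _ fP _ _; exists f => // x; rewrite big_nil mul1r.
move=> /andP[ws us] sP fP sf cop.
have [K KP fE] := sf _ (mem_head _ _).
have [|u us'|u u' us' us''|L LP KE] := IHs K us _ KP.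
- by move=> u us'; apply: sP; rewrite inE us' orbT.
- have us1 : u \in w :: s by rewrite inE us' orbT.
  apply: (coprime_walls_divides (b := w.1) (h := w.2) (l := e w)) => //.
  + exact: sP.
  + exact/sP/mem_head.
  + by apply: cop => //; [exact: mem_head|apply: contraNneq ws => <-].
  by apply: divides_ext (sf u us1).
- by apply: cop; rewrite inE ?us' ?us'' orbT.
by exists L => // x; rewrite big_cons fE KE mulrA.
Qed.

(** * The orbit and the operator cleared of denominators *)

Variables (Phip : {fset V}) (m : V -> nat) (pw : V).
Hypotheses (hpos : positive_roots Phi Phip) (hm : weyl_invariant G Phi m)
  (hpi : minuscule_or_quasi G Phi pw).
Local Notation orbit := (weyl_orbit G Phi pw).

Lemma multiplicity_reflection a b : a \in Phi -> b \in Phi -> m (refl a b) = m b.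
Proof. by move=> aP bP; apply: (hm (weyl_refl aP (weyl_id G Phi)) bP). Qed.

Lemma multiplicityN a : a \in Phi -> m (- a) = m a.
Proof. by move=> aP; rewrite -reflectionxx// multiplicity_reflection. Qed.

(** What minuscule and quasiminuscule coweights have in common; unlike the two
    notions themselves it is visibly inherited by the Weyl orbit. *)
Definition quasiminuscule_pairing (t a : V) : Prop :=
  exists z : int, [/\ ip a t = z%:~R, -2 <= z <= 2,
    z = 2 -> t = coroot G a & z = -2 -> t = - coroot G a].

Lemma quasiminuscule_pairing_base a : a \in Phi -> quasiminuscule_pairing pw a.
Proof.
move=> aP; have small : ip a pw \is a Num.int -> -1 <= ip pw a <= 1 ->
    quasiminuscule_pairing pw a.
  move=> /intrP[z zE]; rewrite ipC zE => /andP[z1 z2].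
  have {}z1 : -1 <= z by rewrite -(ler_int R).
  have {}z2 : z <= 1 by rewrite -(ler_int R).
  exists z; split=> // [|zE'|zE']; [|by rewrite zE' in z2|by rewrite zE' in z1].
  by rewrite (le_trans _ z1)// (le_trans z2).
case: hpi => _ [[Ppw pw1]|[[b bP pwE] pw1]].
  by apply: small; rewrite ?pw1// ipC Ppw.
have [->|ab] := eqVneq a b.
  by exists 2; rewrite pwE ip_coroot//; split.
have [->|aNb] := eqVneq a (- b).
  by exists (- 2); rewrite pwE bilNl ip_coroot// corootN opprK mulrNz; split.
apply: small; first by rewrite pwE ip_root_coroot_int.
by apply: pw1; rewrite ?pwE ?corootK.
Qed.

Lemma orbit_pairing t a : orbit t -> a \in Phi -> quasiminuscule_pairing t a.
Proof.
move=> [w W <-]; elim: W a => [|b {}w bP _ IHw] a aP.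
  exact: quasiminuscule_pairing_base.
have [z [zE z2 zp zn]] := IHw _ (reflection_root bP aP).
exists z; split=> //=; first by rewrite -ip_reflection_l.
  by move=> /zp ->; rewrite reflection_coroot// reflectionK.
move=> /zn ->; rewrite -reflection_coroot// -[RHS](reflectionK bP); congr (refl b _).
by rewrite /reflection bilNl scaleNr opprB addrC opprK.
Qed.

Lemma orbit_reflection a t : a \in Phi -> orbit t -> orbit (refl a t).
Proof. by move=> aP [w W <-]; exists (refl a \o w) => //; exact: weyl_refl. Qed.

(** Roots span and the scalar product is definite. *)
Lemma root_pairing_inj u v : (forall a, a \in Phi -> ip a u = ip a v) -> u = v.
Proof.
move=> uv; apply/eqP; rewrite -subr_eq0; apply/negPn/negP => /ip_gt0.
have uv0 a : a \in Phi -> ip a (u - v) = 0.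
  by move=> /uv; rewrite bilDr bilNr => ->; rewrite subrr.
have dP : u - v \in <<in_tuple (Phi : seq V)>>%VS.
  by case: hPhi => _ -> _ _; exact: memvf.
pose X := in_tuple (Phi : seq V).
rewrite {1}(coord_span dP) -/X; suff -> : forall s : seq 'I_(size Phi),
    ip (\sum_(i <- s) coord X i (u - v) *: X`_i) (u - v) = 0.
  by rewrite ltxx.
elim=> [|i s IHs]; first by rewrite big_nil bil0l.
by rewrite big_cons bilDl IHs addr0 bilZl uv0 ?mulr0//= mem_nth.
Qed.

(** A point of the orbit is determined by its pairings with the roots, which
    take five values. *)
Lemma finite_orbit : finite_set orbit.
Proof.
pose code (t : V) := [ffun p : 'I_(size Phi) * 'I_5 =>
  ip (nth 0 (Phi : seq V) p.1) t == ((p.2 : nat)%:Z - 2)%:~R].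
pose decode c : V := xget 0 [set t | orbit t /\ code t = c]%classic.
apply: (@sub_finite_set _ _ (decode @` setT)%classic); last exact: finite_image.
move=> t Ot; exists (code t) => //=.
have [Ot' tt'] : orbit (decode (code t)) /\ code (decode (code t)) = code t.
  by apply: (@xgetPex _ 0 [set t' | orbit t' /\ code t' = code t]%classic); exists t.
apply: root_pairing_inj => a aP; have [z [zE z2 _ _]] := orbit_pairing Ot aP.
have ia : (index a Phi < size Phi)%N by rewrite index_mem.
have iz : (`|(z + 2)%R|%N < 5)%N by move/andP: z2 => [? ?]; lia.
have /ffunP/(_ (Ordinal ia, Ordinal iz)) := tt'; rewrite !ffunE /= nth_index//.
rewrite (_ : `|z + 2|%:Z - 2 = z); last by move/andP: z2 => [? ?]; lia.
by rewrite zE eqxx => /eqP.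
Qed.

Definition orbit_fset : {fset V} := fset_set orbit.
Local Notation O := orbit_fset.

Lemma orbit_fsetP t : t \in O <-> orbit t.
Proof.
rewrite /orbit_fset in_fset_set; last exact: finite_orbit.
by split=> [/set_mem|Ot]; last exact: mem_set.
Qed.

Lemma perm_orbit_reflection a : a \in Phi -> perm_eq (map (refl a) O) O.
Proof.
move=> aP; apply: uniq_perm.
- by rewrite map_inj_uniq ?fset_uniq//; exact: (can_inj (reflectionK aP)).
- exact: fset_uniq.
move=> b; apply/mapP/idP => [[c /orbit_fsetP cO ->]|/orbit_fsetP bO].
  exact/orbit_fsetP/orbit_reflection.
by exists (refl a b); rewrite ?reflectionK//; exact/orbit_fsetP/orbit_reflection.
Qed.

(** [factor1 b t] and [factor2 b t] are what remains of the factors of b in the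
    coefficient of the shift by t after multiplication by all the walls
    [wall b 0] and [wall b (-1)]. *)
Definition factor1 (b t : V) (x : VC) : R[i] :=
  if 0 < ip b t then qp (- (m b)%:R) * wall b (m b)%:Z x else wall b 0 x.

Definition factor2 (b t : V) (x : VC) : R[i] :=
  if ip b t == 2 then qp (- (m b)%:R) * wall b ((m b)%:Z - 1) x else wall b (-1) x.

Definition cleared_coef (t : V) (x : VC) : R[i] :=
  (\prod_(b <- Phi) factor1 b t x) * \prod_(b <- Phi) factor2 b t x.

Definition denominator (x : VC) : R[i] :=
  (\prod_(b <- Phi) wall b 0 x) * \prod_(b <- Phi) wall b (-1) x.

(** The Macdonald operator multiplied by the common denominator; c stands for
    its constant term. *)
Definition numerator (c : R[i]) (f : VC -> R[i]) (x : VC) : R[i] :=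
  \sum_(t <- O) cleared_coef t x * (f (x + cplx t) - f x) +
  c * (denominator x * f x).

Lemma wpoly_factor1 b t : b \in Phi -> wpoly (factor1 b t).
Proof.
move=> bP; rewrite /factor1; case: (0 < ip b t); last exact: wpoly_wall.
exact/wpolyZ/wpoly_wall.
Qed.

Lemma wpoly_factor2 b t : b \in Phi -> wpoly (factor2 b t).
Proof.
move=> bP; rewrite /factor2; case: (ip b t == 2); last exact: wpoly_wall.
exact/wpolyZ/wpoly_wall.
Qed.

Lemma wpoly_cleared_coef t : wpoly (cleared_coef t).
Proof.
by apply: wpolyM; apply: wpoly_prod => b bP _;
  [exact: wpoly_factor1|exact: wpoly_factor2].
Qed.

Lemma wpoly_denominator : wpoly denominator.
Proof. by apply: wpolyM; apply: wpoly_prod => b bP _; exact: wpoly_wall. Qed.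

Lemma wpoly_numerator c f : wpoly f -> wpoly (numerator c f).
Proof.
move=> fP; apply: wpolyD; last exact/wpolyZ/wpolyM/fP/wpoly_denominator.
apply: wpoly_sum => t _ _; apply: wpolyM; first exact: wpoly_cleared_coef.
by apply: wpolyB => //; exact: wpoly_shift.
Qed.

Lemma numerator_lin c f g u v x :
  numerator c (fun y => u * f y + v * g y) x =
  u * numerator c f x + v * numerator c g x.
Proof.
rewrite /numerator (mulrDr u) (mulrDr v) addrACA; congr (_ + _); last first.
  move: (denominator x) (f x) (g x) => d p r; ring.
rewrite !mulr_sumr -big_split; apply: eq_bigr => t _ /=.
move: (cleared_coef t x) (f (x + cplx t)) (f x) (g (x + cplx t)) (g x).
by move=> d p p' r r'; ring.
Qed.

Lemma eq_numerator c f g x : (forall y, f y = g y) -> numerator c f x = numerator c g x.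
Proof. by move=> /funext ->. Qed.

Lemma wall_creflection a b g x : wall b g (crefl a x) = wall (refl a b) g x.
Proof. by rewrite !wallE character_creflection. Qed.

Lemma cleared_coef_creflection a t x : a \in Phi ->
  cleared_coef t (crefl a x) = cleared_coef (refl a t) x.
Proof.
move=> aP; rewrite /cleared_coef; congr (_ * _).
  rewrite -[RHS](perm_big _ (perm_root_reflection aP)) big_map /=.
  apply: eq_big_seq => b bP; rewrite /factor1 !wall_creflection.
  by rewrite ip_reflection// multiplicity_reflection.
rewrite -[RHS](perm_big _ (perm_root_reflection aP)) big_map /=.
apply: eq_big_seq => b bP; rewrite /factor2 !wall_creflection.
by rewrite ip_reflection// multiplicity_reflection.
Qed.

Lemma denominator_creflection a x : a \in Phi ->
  denominator (crefl a x) = denominator x.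
Proof.
move=> aP; rewrite /denominator; congr (_ * _).
  rewrite -[RHS](perm_big _ (perm_root_reflection aP)) big_map /=.
  by apply: eq_bigr => b _; rewrite wall_creflection.
rewrite -[RHS](perm_big _ (perm_root_reflection aP)) big_map /=.
by apply: eq_bigr => b _; rewrite wall_creflection.
Qed.

(** The operator commutes with reflections: the reflection permutes the shifts
    in the orbit together with their coefficients. *)
Lemma numerator_creflection a c f x : a \in Phi ->
  numerator c f (crefl a x) = numerator c (fun y => f (crefl a y)) x.
Proof.
move=> aP; rewrite /numerator denominator_creflection//; congr (_ + _).
rewrite -[RHS](perm_big _ (perm_orbit_reflection aP)) big_map /=.
apply: eq_bigr => t _; rewrite cleared_coef_creflection//.
by rewrite creflectionD creflection_cplx reflectionK.
Qed.

Lemma root_split a : a \in Phi -> exists s : seq V,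
  perm_eq Phi [:: a, - a & s] /\
  forall b, b \in s -> [/\ b \in Phi, b != a & b != - a].
Proof.
move=> aP; exists (rem (- a) (rem a Phi)).
have NaN : - a != a.
  apply/eqP => aN; have := ip_coroot aP; rewrite -{1}aN bilNl ip_coroot// => /eqP.
  by rewrite -subr_eq0 -opprD oppr_eq0 -natrD pnatr_eq0.
have NaP : - a \in rem a Phi.
  by rewrite mem_rem_uniq ?fset_uniq// inE NaN /= rootN.
split.
  by apply: (perm_trans (perm_to_rem aP)); rewrite perm_cons perm_to_rem.
move=> b; rewrite mem_rem_uniq ?rem_uniq ?fset_uniq// inE.
by rewrite mem_rem_uniq ?fset_uniq// inE => /and3P[].
Qed.

(** The four factors of the coefficient with poles or zeros on the walls
    parallel to a fixed root hyperplane. *)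
Lemma cleared_coef_split a t : a \in Phi -> exists2 r, wpoly r & forall x,
  cleared_coef t x = factor1 a t x * factor2 a t x *
    (factor1 (- a) t x * (factor2 (- a) t x * r x)).
Proof.
move=> aP; have [s [sE sP]] := root_split aP.
exists (fun x => (\prod_(b <- s) factor1 b t x) * \prod_(b <- s) factor2 b t x).
  by apply: wpolyM; apply: wpoly_prod => b /sP[bP _ _] _;
    [exact: wpoly_factor1|exact: wpoly_factor2].
move=> x; rewrite /cleared_coef !(perm_big _ sE) !big_cons /=.
move: (factor1 a t x) (factor2 a t x) (factor1 (- a) t x) (factor2 (- a) t x).
move: (\prod_(_ <- s) _) (\prod_(_ <- s) _) => A B p r p' r'.
by ring.
Qed.

Lemma denominator_split a : a \in Phi -> exists s : seq V,
  [/\ perm_eq Phi (- a :: s), forall b, b \in s -> b \in Phi /\ b != - a & forall x,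
  denominator x = wall (- a) (-1) x *
    ((\prod_(b <- Phi) wall b 0 x) * \prod_(b <- s) wall b (-1) x)].
Proof.
move=> aP; have pE := perm_to_rem (rootN aP).
exists (rem (- a) Phi); split=> // [b|x].
  by rewrite mem_rem_uniq ?fset_uniq// inE => /andP[].
rewrite /denominator [RHS]mulrCA; congr (_ * _).
by rewrite (perm_big _ pE) big_cons.
Qed.

(** * Quasi-invariance and the zeros of the cleared operator *)

(** Modulo the periods of f, the two points compared in the definition of
    quasi-invariance are exchanged by the reflection in a. *)
Lemma quasi_invariantP a j f : a \in Phi -> wpoly f ->
  (forall x, qp (2 * pc a x) = 1 ->
     f (x + (j%:R / 2) *: cplx (coroot G a)) =
     f (x - (j%:R / 2) *: cplx (coroot G a))) <->
  (forall x, wall a j x = 0 -> f x - f (crefl a x) = 0).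
Proof.
move=> aP fP; pose h : VC := (j%:R / 2) *: cplx (coroot G a).
have ha : chi a h = qp (2 * j%:R).
  by rewrite characterE pairCZr pairC_cplx ip_coroot// rmorph_nat divfK ?pnatr_eq0.
have sh x : chi a x = 1 -> f (crefl a (x + h)) = f (x - h).
  move=> x1; have x0 : wall a 0 x = 0.
    by apply/wall_eq0; rewrite x1 mulr0 qpow0.
  have hh : crefl a h = - h.
    rewrite /creflection /h pairCZr pairC_cplx ip_coroot// rmorph_nat.
    by rewrite divfK ?pnatr_eq0// -scalerBl -scaleNr; congr (_ *: _); field.
  have := affine_reflection_wall (- h) aP fP x0.
  by rewrite /affine_reflection scale0r addr0 creflectionD hh.
split=> [H x /wall_eq0 xE|H x]; last first.
  rewrite -characterE -/h => x1; rewrite -sh//; apply/eqP; rewrite -subr_eq0; apply/eqP.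
  by apply: H; apply/wall_eq0; rewrite characterDr x1 mul1r ha.
have x1 : chi a (x - h) = 1.
  apply: (mulIf (character_neq0 a h)); rewrite mul1r -characterDr subrK xE ha.
  by [].
have E : f (x - h + h) = f (crefl a (x - h + h)).
  by rewrite (sh _ x1); apply: H; rewrite -characterE.
by rewrite subrK in E; rewrite -E subrr.
Qed.

Definition vanishes_on_walls (a : V) (F : VC -> R[i]) : Prop :=
  forall (j : int) x, `|j| <= (m a)%:Z -> wall a j x = 0 -> F x = 0.

Lemma wall_creflection_root a j x : a \in Phi ->
  wall a j (crefl a x) = 0 <-> wall a (- j) x = 0.
Proof. by move=> aP; rewrite wall_creflection reflectionxx//; exact: wallN_eq0. Qed.

(** The conditions for positive j extend to j = 0 by periodicity, to negative j
    because f - f o s is odd under the reflection s, and to negative roots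
    because a and - a define the same reflection. *)
Lemma skew_part_vanishes a f : a \in Phi ->
  quasi_invariants G Phi Phip logq m f ->
  vanishes_on_walls a (fun x => f x - f (crefl a x)).
Proof.
have pos b j x : b \in Phip -> quasi_invariants G Phi Phip logq m f ->
    `|j| <= (m b)%:Z -> wall b j x = 0 -> f x - f (crefl b x) = 0.
  move=> bPp [fP fq] jm; have bP : b \in Phi by case: hpos => /fsubsetP/(_ _ bPp).
  have posj (k : nat) y : (k <= m b)%N -> wall b k y = 0 -> f y - f (crefl b y) = 0.
    case: k => [_ wy|k km]; last first.
      by apply: (iffLR (quasi_invariantP _ bP fP)) => z; apply: fq => //.
    have := affine_reflection_wall 0 bP fP wy.
    by rewrite /affine_reflection scale0r !addr0 => ->; rewrite subrr.
  case: j jm => k km wx; first by apply: (posj k) => //; lia.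
  have := posj k.+1 (crefl b x); rewrite creflectionK// => H.
  apply/eqP; rewrite -oppr_eq0 opprB; apply/eqP/H; first by lia.
  by apply/(wall_creflection_root _ _ bP); rewrite -NegzE.
move=> aP fq j x jm wx; case: hpos => _ /(_ a aP) + _.
have [aPp _|_ /= NaPp] := boolP (a \in Phip); first exact: pos wx.
rewrite -creflectionN; apply: (pos (- a) (- j)) => //.
  by rewrite normrN multiplicityN.
by apply/wallN_eq0; rewrite opprK.
Qed.

Lemma vanishesN a F : a \in Phi -> vanishes_on_walls a F -> vanishes_on_walls (- a) F.
Proof.
move=> aP FV j x jm wx; apply: (FV (- j)); last exact/wallN_eq0.
by rewrite normrN; rewrite multiplicityN in jm.
Qed.

Lemma wall_shift a t j (z : int) x : ip a t = z%:~R -> wall a j x = 0 ->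
  wall a (j + z) (x + cplx t) = 0.
Proof.
move=> zE /wall_eq0 xE; apply/wall_eq0; rewrite characterDr xE rmorphD mulrDr qpowD.
by rewrite characterE pairC_cplx zE rmorph_int.
Qed.

(** If x lies on one of the walls where F vanishes but its translate by t does
    not, then the translation crosses the last wall, and there one of the
    numerators vanishes. *)
Lemma factors_cancel a t F j x : a \in Phi -> t \in O -> vanishes_on_walls a F ->
  0 <= j <= (m a)%:Z -> 1 <= j \/ 0 < ip a t -> wall a j x = 0 ->
  factor1 a t x * factor2 a t x * F (x + cplx t) = 0.
Proof.
move=> aP /orbit_fsetP tO FV /andP[j0 jm] jt wx.
have [z [zE /andP[z1 z2] _ _]] := orbit_pairing tO aP.
have [small|big] := lerP `|j + z| (m a)%:Z.
  by rewrite (FV _ _ small (wall_shift zE wx)) mulr0.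
have z0 : 0 < z.
  case: jt => [j1|]; last by rewrite zE ltr0z.
  move: big; rewrite ltr_normr; lia.
have ipt : 0 < ip a t by rewrite zE ltr0z.
have jmz : (m a)%:Z < j + z by move: big; rewrite ltr_normr; lia.
rewrite /factor1 ipt /factor2.
have [jE|jNm] := eqVneq j (m a)%:Z; first by rewrite -jE wx mulr0 !mul0r.
have zE2 : z = 2 by lia.
have jE : (m a)%:Z - 1 = j by lia.
by rewrite zE zE2 eqxx jE wx !mulr0 mul0r.
Qed.

Lemma divides_mulr D X Y : divides D X -> wpoly Y -> divides D (fun x => X x * Y x).
Proof.
by move=> DX YP; apply: divides_ext (dividesMl DX YP) => x; rewrite mulrC.
Qed.

Lemma divides_wallN a g X : a \in Phi ->
  divides (wall a (- g)) X -> divides (wall (- a) g) X.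
Proof.
move=> aP [K KP XE]; exists (fun x => - qp (2 * (- g)%:~R) * chi a x * K x).
  by apply: wpolyM => //; exact/wpolyZ/wpoly_character/weight_root.
move=> x; rewrite XE wallN mulrNz mulrN qpowN characterN.
have := character_neq0 a x; have := qpow_neq0 (2 * g%:~R).
by move: (qp _) (chi a x) (wall a _ x) (K x) => p r w k p0 r0; field; rewrite p0.
Qed.

Lemma divides_wallN2 a X : a \in Phi ->
  divides (fun x => wall (- a) 0 x * wall (- a) 0 x) X ->
  divides (fun x => wall a 0 x * wall a 0 x) X.
Proof.
move=> aP [K KP XE]; exists (fun x => chi (- a) x ^+ 2 * K x).
  by apply: wpolyM => //; exact/wpolyX/wpoly_character/weightN/weight_root.
move=> x; rewrite XE wallN oppr0 mulr0 qpow0.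
by move: (chi _ x) (wall a 0 x) (K x) => p w k; ring.
Qed.

Lemma divides_cleared_coef a t : a \in Phi -> divides (wall a 0) (cleared_coef t).
Proof.
move=> aP; apply: wall_divides => //; first exact: wpoly_cleared_coef.
move=> x wx; have [r _ ->] := cleared_coef_split t aP.
rewrite /factor1 bilNl; have [at0|at0] := ltP 0 (ip a t); last by rewrite wx !mul0r.
rewrite ltNge oppr_le0 (ltW at0) /=.
have /wallN_eq0 -> : wall a (- 0) x = 0 by rewrite oppr0.
by rewrite !(mul0r, mulr0).
Qed.

Lemma divides_denominator0 a : a \in Phi -> divides (wall a 0) denominator.
Proof.
move=> aP; apply: wall_divides => //; first exact: wpoly_denominator.
by move=> x wx; rewrite /denominator (big_rem a aP) /= wx !mul0r.
Qed.

Lemma divides_denominatorN1 a : a \in Phi -> divides (wall a (-1)) denominator.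
Proof.
move=> aP; apply: wall_divides => //; first exact: wpoly_denominator.
by move=> x wx; rewrite /denominator [X in _ * X](big_rem a aP) /= wx !(mul0r,mulr0).
Qed.

(** The double zero comes once from a wall in the coefficient and once from the
    vanishing of F or of a numerator. *)
Lemma divides_skew_term a t F : a \in Phi -> t \in O -> wpoly F ->
  vanishes_on_walls a F ->
  divides (fun x => wall a 0 x * wall a 0 x)
    (fun x => cleared_coef t x * F (x + cplx t)).
Proof.
have pos b : b \in Phi -> t \in O -> wpoly F -> vanishes_on_walls b F ->
    0 < ip b t -> divides (fun x => wall b 0 x * wall b 0 x)
      (fun x => cleared_coef t x * F (x + cplx t)).
  move=> bP tO FP FV bt; have [r rP rE] := cleared_coef_split t bP.
  have D1 : divides (wall b 0) (fun x => factor1 b t x * factor2 b t x * F (x + cplx t)).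
    apply: wall_divides => //.
      apply: wpolyM; last exact: wpoly_shift.
      by apply: wpolyM; [exact: wpoly_factor1|exact: wpoly_factor2].
    by move=> x wx; apply: (factors_cancel (j := 0)) => //; right.
  have D2 : divides (wall b 0) (factor1 (- b) t).
    rewrite /factor1 bilNl ltNge oppr_le0 (ltW bt) /=.
    rewrite -{1}[b]opprK; apply: divides_wallN; rewrite ?rootN ?oppr0//.
    exact: divides_refl.
  have D3 := divides_mulr D2 (wpolyM (wpoly_factor2 t (rootN bP)) rP).
  by apply: divides_ext (dividesM D1 D3) => x; rewrite rE mulrAC.
move=> aP tO FP FV; have [at0|at0|at0] := ltrgtP 0 (ip a t).
- exact: pos.
- apply: divides_wallN2 => //; apply: pos; rewrite ?rootN//; first exact: vanishesN.
  by rewrite bilNl oppr_gt0.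
have [r rP rE] := cleared_coef_split t aP.
have D2 : divides (wall a 0) (factor1 (- a) t).
  rewrite /factor1 bilNl -at0 oppr0 ltxx.
  rewrite -{1}[a]opprK; apply: divides_wallN; rewrite ?rootN ?oppr0//.
  exact: divides_refl.
have D1 : divides (wall a 0) (factor1 a t).
  by rewrite /factor1 -at0 ltxx; exact: divides_refl.
have FtP : wpoly (fun x => F (x + cplx t)) by exact: wpoly_shift.
have D3 := divides_mulr D1 (wpolyM (wpoly_factor2 t aP) FtP).
have D4 := divides_mulr D2 (wpolyM (wpoly_factor2 t (rootN aP)) rP).
apply: divides_ext (dividesM D3 D4) => x; rewrite rE.
by rewrite [RHS]mulrAC -[in RHS](mulrA (factor1 a t x)).
Qed.

Lemma divides_cst c D X : divides D X -> divides D (fun x => c * X x).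
Proof. by move=> DX; apply: dividesMl => //; exact: wpoly_cst. Qed.

Lemma dividesB D X Y : divides D X -> divides D Y -> divides D (fun x => X x - Y x).
Proof.
move=> DX DY; apply: divides_ext (dividesD DX (divides_cst (-1) DY)) => x.
by rewrite mulN1r.
Qed.

Lemma divides_numerator0_even a c f : a \in Phi -> wpoly f ->
  (forall x, f (crefl a x) = f x) ->
  divides (fun x => wall a 0 x * wall a 0 x) (numerator c f).
Proof.
move=> aP fP even; apply: (even_divides aP (wpoly_numerator c fP)) => [x|x wx].
  rewrite /affine_reflection scale0r addr0 (numerator_creflection _ _ _ aP).
  exact: eq_numerator.
rewrite /numerator big1_seq => [|t _].
  by have [K _ ->] := divides_denominator0 aP; rewrite wx !(mul0r,mulr0) addr0.
by have [K _ ->] := divides_cleared_coef t aP; rewrite wx !mul0r.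
Qed.

Lemma divides_numerator0_skew a c F : a \in Phi -> wpoly F ->
  vanishes_on_walls a F ->
  divides (fun x => wall a 0 x * wall a 0 x) (numerator c F).
Proof.
move=> aP FP FV; have FD : divides (wall a 0) F.
  by apply: wall_divides => // x; apply: FV.
apply: dividesD; last first.
  exact/divides_cst/dividesM/FD/divides_denominator0.
apply: divides_sum => t tO.
have D1 := divides_skew_term aP tO FP FV.
have D2 := dividesM (divides_cleared_coef t aP) FD.
by apply: divides_ext (dividesB D1 D2) => x; rewrite [RHS]mulrBr.
Qed.

(** Split f into its even and odd parts under the reflection in a: for the even
    part first order vanishing is second order vanishing, for the odd part every
    term vanishes twice. *)
Lemma divides_numerator0 a c f : a \in Phi ->
  quasi_invariants G Phi Phip logq m f ->
  divides (fun x => wall a 0 x * wall a 0 x) (numerator c f).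
Proof.
move=> aP fq; have [fP _] := fq.
have fsP : wpoly (fun x => f (crefl a x)) by exact: wpoly_creflection.
have D1 : divides (fun x => wall a 0 x * wall a 0 x)
    (numerator c (fun x => f x + f (crefl a x))).
  apply: (divides_numerator0_even c aP (wpolyD fP fsP)) => x.
  by rewrite (creflectionK aP) addrC.
have D2 := divides_numerator0_skew c aP (wpolyB fP fsP) (skew_part_vanishes aP fq).
apply: divides_ext (dividesD (divides_cst 2^-1 D1) (divides_cst 2^-1 D2)) => x.
rewrite -numerator_lin; apply: eq_numerator => y.
by move: (f y) (f _) => u v; field.
Qed.

(** Every coefficient but that of the shift by the coroot of a contains the
    wall, and at that shift the reflection identifies f (x + t) with f x. *)
Lemma divides_numeratorN1 a c f : a \in Phi ->
  quasi_invariants G Phi Phip logq m f ->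
  divides (wall a (-1)) (numerator c f).
Proof.
move=> aP fq; have [fP _] := fq; have FV := skew_part_vanishes aP fq.
apply: (wall_divides aP (wpoly_numerator c fP)) => x wx.
rewrite /numerator big1_seq => [|t /andP[_ tO]].
  by have [K _ ->] := divides_denominatorN1 aP; rewrite wx !(mul0r,mulr0) addr0.
have [r _ ->] := cleared_coef_split t aP; rewrite /factor2.
have [at2|_] := eqVneq (ip a t) 2; last by rewrite wx !(mul0r,mulr0).
have [ma|ma] := posnP (m a).
  by rewrite ma sub0r wx !(mul0r,mulr0).
have [z [zE _ zp _]] := orbit_pairing (iffLR (orbit_fsetP t) tO) aP.
have z2 : z = 2 by apply/eqP; rewrite -(eqr_int R) -zE at2.
have tE : t = coroot G a by exact: zp.
have wy := wall_shift zE wx; rewrite z2 in wy.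
have -> : f (x + cplx t) = f x.
  have /eqP := FV (-1 + 2) _ ma wy; rewrite subr_eq0 => /eqP ->.
  rewrite creflectionD creflection_cplx tE reflection_corootxx// cplxN.
  have := affine_reflection_wall 0 aP fP wx.
  by rewrite !addr0 /affine_reflection rmorphN1 scaleN1r.
by rewrite subrr mulr0.
Qed.

(** * The quotient and its quasi-invariance *)

Lemma positive_root a : a \in Phip -> a \in Phi.
Proof. by case: hpos => /fsubsetP + _ _; apply. Qed.

Lemma positive_rootN a : a \in Phip -> - a \notin Phip.
Proof.
move=> aP; case: hpos => _ /(_ a (positive_root aP)) + _.
by rewrite aP /=.
Qed.

Lemma perm_positive_roots :
  perm_eq Phi ((Phip : seq V) ++ [seq - a | a <- (Phip : seq V)]).
Proof.
apply: uniq_perm; first exact: fset_uniq.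
  rewrite cat_uniq fset_uniq /= (map_inj_uniq (@oppr_inj _)) fset_uniq andbT.
  by apply/hasPn => _ /mapP[a aP ->]; exact: positive_rootN.
move=> a; rewrite mem_cat; apply/idP/orP => [aP|[/positive_root//|/mapP[b bP ->]]].
  case: hpos => _ /(_ a aP) + _.
  case: (boolP (a \in Phip)) => [_ _|_ /= NaP]; first by left.
  by right; apply/mapP; exists (- a); rewrite ?opprK.
exact/rootN/positive_root.
Qed.

Definition pole_walls : seq (V * int) :=
  [seq (a, 0) | a <- (Phip : seq V)] ++ [seq (a, -1) | a <- (Phi : seq V)].

Definition pole_order (w : V * int) : nat := if w.2 == 0 then 2 else 1.

Lemma mem_pole_walls w : w \in pole_walls ->
  (w.1 \in Phip /\ w.2 = 0) \/ (w.1 \in Phi /\ w.2 = -1).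
Proof.
by rewrite mem_cat => /orP[] /mapP[a aP ->]; [left|right].
Qed.

Lemma uniq_pole_walls : uniq pole_walls.
Proof.
have inj j : injective (fun a : V => (a, j : int)) by move=> a b [].
rewrite cat_uniq !(map_inj_uniq (inj _)) !fset_uniq andbT /=.
by apply/hasPn => _ /mapP[a _ ->]; apply/negP => /mapP[b _ []].
Qed.

Lemma coprime_pole_walls w w' : w \in pole_walls -> w' \in pole_walls -> w != w' ->
  coprime_walls w.1 w.2 w'.1 w'.2.
Proof.
move=> /mem_pole_walls wP /mem_pole_walls wP' ww'.
have rP u : (u.1 \in Phip /\ u.2 = 0 :> int) \/ (u.1 \in Phi /\ u.2 = -1) -> u.1 \in Phi.
  by case=> [[/positive_root]|[]].
have [E|N1] := eqVneq w'.1 w.1.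
  rewrite E; apply: coprime_walls_same; apply: contraNneq ww' => E2.
  by apply/eqP; case: w w' E E2 {wP wP'} => ? ? [? ?] /= -> ->.
have [E|N2] := eqVneq w'.1 (- w.1); last first.
  by apply: coprime_walls_nonproportional => //; exact: rP.
rewrite E; apply: coprime_walls_opp; rewrite E in wP'.
case: wP wP' => [[wp ->]|[_ ->]] [[wp' ->]|[_ ->]] //.
by have := positive_rootN wp; rewrite wp'.
Qed.

Lemma denominator_pole_walls x : denominator x =
  (\prod_(a <- Phip) (- chi (- a) x)) *
  \prod_(w <- pole_walls) wall w.1 w.2 x ^+ pole_order w.
Proof.
rewrite /denominator (perm_big _ perm_positive_roots) /pole_walls !big_cat !big_map /=.
rewrite mulrA -!big_split /=; congr (_ * _); apply: eq_bigr => a _.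
rewrite wallN oppr0 mulr0 qpow0 /pole_order /=.
by move: (chi _ x) (wall a 0 x) => u w; ring.
Qed.

(** The factors of a and - a in the denominator are proportional, so its
    coprime factors are squares of walls indexed by the positive roots, and the
    walls [wall a (-1)]. *)
Lemma denominator_divides_numerator c f :
  quasi_invariants G Phi Phip logq m f -> divides denominator (numerator c f).
Proof.
move=> fq; have [fP _] := fq.
have [|w wP|K KP KE] := divides_prod_walls (e := pole_order) uniq_pole_walls _
    (wpoly_numerator c fP) _ coprime_pole_walls.
- by move=> w /mem_pole_walls[[/positive_root]|[]].
- rewrite /pole_order; move/mem_pole_walls: wP; case: w => a j /= [[aP ->]|[aP ->]] /=.
    have := divides_numerator0 c (positive_root aP) fq.
    by case=> L LP LE; exists L => // x; rewrite LE expr2.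
  have [L LP LE] := divides_numeratorN1 c aP fq.
  by exists L => // x; rewrite LE expr1.
exists (fun x => K x * \prod_(a <- Phip) (- chi a x)).
  apply: wpolyM => //; apply: wpoly_prod => a aP _.
  exact/wpolyN/wpoly_character/weight_root/positive_root.
move=> x; rewrite KE denominator_pole_walls.
have : (\prod_(a <- Phip) (- chi (- a) x)) * (\prod_(a <- Phip) (- chi a x)) = 1.
  rewrite -big_split big1_seq //= => a _.
  by rewrite mulrNN characterN mulVf ?character_neq0.
move: (\prod_(a <- Phip) (- chi (- a) x)) (\prod_(a <- Phip) (- chi a x)) => A B AB.
move: (\prod_(w <- _) _) (K x) => C D.
by rewrite (mulrC D) mulrACA AB mul1r.
Qed.

Lemma coprime_prod_walls a j (s : seq V) g X : (forall b, b \in s -> b \in Phi) ->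
  (forall b, b \in s -> coprime_walls a j b g) -> wpoly X ->
  (forall x, wall a j x = 0 -> (\prod_(b <- s) wall b g x) * X x = 0) ->
  forall x, wall a j x = 0 -> X x = 0.
Proof.
move=> sP cop XP; elim: s sP cop => [|b s IHs] sP cop H.
  by move=> x /H; rewrite big_nil mul1r.
apply: IHs => [c cs|c cs|]; [apply: sP|apply: cop|]; rewrite ?inE ?cs ?orbT//.
apply: (cop b (mem_head _ _)).
  apply: wpolyM => //; apply: wpoly_prod => c cs _.
  by apply/wpoly_wall/sP; rewrite inE cs orbT.
by move=> x /H; rewrite big_cons mulrA.
Qed.

(** Only the factor of - a in the second product can vanish identically on a
    component of a wall of quasi-invariance of a, namely on the wall j = 1; the
    remaining factors can be cancelled there. *)
Lemma denominator_cancel a (j : nat) : a \in Phi -> (0 < j)%N ->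
  exists2 D, wpoly D & (forall x, denominator x = wall (- a) (-1) x * D x) /\
    forall X, wpoly X -> (forall x, wall a j x = 0 -> D x * X x = 0) ->
      forall x, wall a j x = 0 -> X x = 0.
Proof.
move=> aP j0; have [s [_ sP DE]] := denominator_split aP.
exists (fun x => (\prod_(b <- Phi) wall b 0 x) * \prod_(b <- s) wall b (-1) x).
  apply: wpolyM; apply: wpoly_prod => b bP _; apply: wpoly_wall => //.
  by case: (sP b bP).
split=> // X XP H.
have cop b g : b \in Phi -> (b != - a) || (g == 0) -> (g == 0) || (g == -1) ->
    coprime_walls a j b g.
  move=> bP bg g01; have [->|ba] := eqVneq b a.
    by apply: coprime_walls_same; case/orP: g01 => /eqP ->; lia.
  have [bE|bNa] := eqVneq b (- a); last exact: coprime_walls_nonproportional.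
  rewrite bE; apply: coprime_walls_opp; move: bg; rewrite bE eqxx /= => /eqP ->.
  by lia.
apply: (@coprime_prod_walls a j s (-1)) => //.
- by move=> b /sP[].
- by move=> b /sP[bP bNa]; apply: cop; rewrite ?bNa ?orbT.
apply: (@coprime_prod_walls a j Phi 0) => //.
- by move=> b bP; apply: cop; rewrite ?eqxx ?orbT.
- by apply: wpolyM => //; apply: wpoly_prod => b /sP[bP _] _; exact: wpoly_wall.
by move=> x /H; rewrite mulrA.
Qed.

Lemma divides_factor2N a t : a \in Phi -> ip a t != -2 ->
  divides (wall a 1) (factor2 (- a) t).
Proof.
move=> aP at2; rewrite /factor2 bilNl eqr_oppLR (negPf at2).
rewrite -{1}[a]opprK; apply: divides_wallN; rewrite ?rootN//.
exact: divides_refl.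
Qed.

(** For j > 1 the shifts keep x inside the strip of walls where F vanishes,
    except where a numerator vanishes. *)
Lemma numerator_skew_vanishes a c F (j : nat) x : a \in Phi -> wpoly F ->
  vanishes_on_walls a F -> (1 < j <= m a)%N -> wall a j x = 0 ->
  numerator c F x = 0.
Proof.
move=> aP FP FV /andP[j1 jm] wx; have Fx : F x = 0 by apply: (FV j).
rewrite /numerator Fx !mulr0 addr0 big1_seq// => t /andP[_ tO].
have [r _ ->] := cleared_coef_split t aP; rewrite subr0 mulrAC.
rewrite (factors_cancel (j := j) aP tO FV) ?mul0r//; last by left; lia.
Qed.

(** On the wall j = 1 the denominator vanishes, so second order vanishing is
    needed. The only shift whose coefficient does not contain the wall is
    - a^vee, and there F (x + t) - F x is even under the reflection in the
    hyperplane (a, x) = 1. *)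
Lemma divides_numerator1_skew a c F : a \in Phi -> wpoly F ->
  (forall x, F (crefl a x) = - F x) -> vanishes_on_walls a F -> (0 < m a)%N ->
  divides (fun x => wall a 1 x * wall a 1 x) (numerator c F).
Proof.
move=> aP FP skew FV ma.
have FD : divides (wall a 1) F.
  by apply: wall_divides => // x; apply: FV; rewrite lez_nat.
apply: dividesD; last first.
  apply/divides_cst/dividesM/FD.
  rewrite -{1}[a]opprK; apply: divides_wallN; rewrite ?rootN//.
  exact/divides_denominatorN1/rootN.
apply: divides_sum => t tO; have [r rP rE] := cleared_coef_split t aP.
have [at2|at2] := eqVneq (ip a t) (-2); last first.
  have D2 := divides_factor2N aP at2.
  have D3 := dividesMl (divides_mulr D2 rP) (wpoly_factor1 t (rootN aP)).
  have D4 : divides (wall a 1) (fun x => factor1 a t x * factor2 a t x * F (x + cplx t)).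
    apply: wall_divides => //.
      apply: wpolyM; last exact: wpoly_shift.
      by apply: wpolyM; [exact: wpoly_factor1|exact: wpoly_factor2].
    by move=> x wx; apply: (factors_cancel (j := 1)) => //; left.
  have D5 := dividesMl FD (wpolyM (wpoly_factor1 t aP) (wpoly_factor2 t aP)).
  apply: divides_ext (dividesM (dividesB D4 D5) D3) => x.
  by rewrite rE -mulrBr [RHS]mulrAC.
have [z [zE _ _ zn]] := orbit_pairing (iffLR (orbit_fsetP t) tO) aP.
have z2 : z = -2 by apply/eqP; rewrite -(eqr_int R) -zE at2.
have tE := zn z2.
have tP : wpoly (fun x => F (x + cplx t)) by exact: wpoly_shift.
have rt : crefl a (cplx t) = - cplx t.
  by rewrite creflection_cplx tE -reflectionN -corootN reflection_corootxx ?rootN// cplxN.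
have tE1 x : affine_reflection a 1 x = crefl a (x + cplx t).
  by rewrite creflectionD rt /affine_reflection scale1r tE cplxN opprK.
have tE2 x : affine_reflection a 1 x + cplx t = crefl a x.
  by rewrite tE1 creflectionD rt subrK.
apply: dividesMl; last exact: wpoly_cleared_coef.
apply: (even_divides aP (wpolyB tP FP)) => [x|x wx].
  by rewrite tE2 tE1 (skew x) (skew (x + _)) opprK addrC.
have wy := wall_shift zE wx; rewrite z2 in wy.
rewrite (FV _ _ _ wy); last by rewrite lez_nat.
by rewrite (FV _ _ _ wx) ?subrr// lez_nat.
Qed.

(** The difference g - g o s is the quotient by the denominator of the operator
    applied to f - f o s. *)
Lemma quotient_quasi_invariant c f g : quasi_invariants G Phi Phip logq m f ->
  wpoly g -> (forall x, numerator c f x = denominator x * g x) ->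
  quasi_invariants G Phi Phip logq m g.
Proof.
move=> fq gP gE; split=> // a j aPp /andP[j1 jm].
have [fP _] := fq; have aP := positive_root aPp.
apply: (iffRL (quasi_invariantP j aP gP)).
have FV := skew_part_vanishes aP fq.
have FP : wpoly (fun x => f x - f (crefl a x)).
  by apply: wpolyB => //; exact: wpoly_creflection.
have uP : wpoly (fun x => g x - g (crefl a x)).
  by apply: wpolyB => //; exact: wpoly_creflection.
have uE x : numerator c (fun y => f y - f (crefl a y)) x =
    denominator x * (g x - g (crefl a x)).
  rewrite mulrBr -gE -{1}(denominator_creflection x aP) -gE.
  rewrite (numerator_creflection _ _ _ aP) -[X in X - _]mul1r -mulN1r -numerator_lin.
  by apply: eq_numerator => y; rewrite mul1r mulN1r.
have [D DP [DE cancelD]] := denominator_cancel aP j1.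
apply: cancelD => //; case: (ltnP 1 j) => j2 x wx.
  have /eqP := numerator_skew_vanishes c aP FP FV (introT andP (conj j2 jm)) wx.
  rewrite uE DE -mulrA mulf_eq0 => /orP[/eqP/wallN_eq0 wx'|/eqP //].
  exfalso; have : 1 - (j : int) != 0 by lia.
  move=> /qpow2_int_neq1 /eqP; apply.
  move: wx wx' => /wall_eq0 wx /wall_eq0; rewrite wx opprK => E.
  by rewrite rmorphB mulrBr qpowD qpowN E mulfV// qpow_neq0.
have jE : j = 1%N by apply/eqP; rewrite eqn_leq j2.
rewrite {}jE in wx jm *.
have [|K KP KE] := divides_numerator1_skew c aP FP _ FV jm.
  by move=> y; rewrite creflectionK// opprB.
pose k : R[i] := qp (2 * (-1)%:~R).
(* One of the two walls in K cancels against the denominator. *)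
have L : forall y, wall a 1 y * K y +
    k * (chi (- a) y * (D y * (g y - g (crefl a y)))) = 0.
  apply: (@wall_cancel _ a 1 aP) => [|y].
    apply: wpolyD; first exact/wpolyM/KP/wpoly_wall.
    apply/wpolyZ/wpolyM; first exact/wpoly_character/weightN/weight_root.
    exact: wpolyM.
  have := uE y; rewrite KE DE wallN opprK -/k.
  move: (k) (wall a 1 y) (chi _ y) (D y) (K y) (g y - g _) => e w h d l u E.
  by rewrite mulrDr mulrA E; ring.
have k0 : k != 0 by exact: qpow_neq0.
have := L x; rewrite wx mul0r add0r => E.
by apply: (mulfI (character_neq0 (- a) x)); apply: (mulfI k0); rewrite !mulr0.
Qed.

(** * Values at regular points *)

Lemma wall_prod_cancel (s : seq V) (P : pred V) g X :
  (forall b, b \in s -> b \in Phi) -> wpoly X ->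
  (forall x, (\prod_(b <- s | P b) wall b g x) * X x = 0) -> forall x, X x = 0.
Proof.
move=> + XP; elim: s => [|b s IHs] bsP H.
  by move=> x; have := H x; rewrite big_nil mul1r.
have sP c : c \in s -> c \in Phi by move=> cs; apply: bsP; rewrite inE cs orbT.
apply: IHs => //; case Pb : (P b); last first.
  by move=> x; have := H x; rewrite big_cons Pb.
apply: (@wall_cancel _ b g); first exact/bsP/mem_head.
  by apply: wpolyM => //; apply: wpoly_prod => c cs _; exact/wpoly_wall/sP.
by move=> x; have := H x; rewrite big_cons Pb mulrA.
Qed.

Local Notation mult := (fun a => - (m a)%:R : R[i]).

(** Both families of factors at once: z = (a, x) with c = 1, j = 0, and
    z = 1 + (a, x) with c = q^2, j = -1. *)
Lemma macd_factor_wall b x z c j :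
  qp (2 * z) = c * chi b x -> c * qp (2 * j%:~R) = 1 ->
  macd_den logq z = (qp z)^-1 * c * wall b j x /\
  macd_num logq mult b z =
    (qp z)^-1 * c * (qp (- (m b)%:R) * wall b ((m b)%:Z + j) x).
Proof.
move=> zE cj; have z0 := qpow_neq0 z; have zE2 : qp z * qp z = c * chi b x.
  by rewrite -zE -qpowD; congr qp; rewrite mulr_natl mulr2n.
have dup (u v w : R[i]) : u != 0 -> u * u = w -> u^-1 * (w - v) = u - u^-1 * v.
  by move=> u0 <-; field.
split.
  rewrite wallE -mulrA mulrBr -zE2 cj dup// mulr1 /macd_den qpowN.
  by [].
rewrite wallE /macd_num qpowN.
have m0 := qpow_neq0 (m b)%:R.
have -> : qp (2 * ((m b)%:Z + j)%:~R) = qp (m b)%:R ^+ 2 * qp (2 * j%:~R).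
  by rewrite rmorphD mulrDr qpowD -qpowMn; congr (qp _ * _); rewrite mulrC.
rewrite qpowN invrK -mulrA [c * _]mulrCA mulrBr [c * (_ * _)]mulrCA cj mulr1 -zE2.
by move: (qp z) (qp (m b)%:R) z0 m0 => u v u0 v0; field; rewrite u0 v0.
Qed.

Lemma fraction_cancel (u v w : R[i]) : u != 0 -> u * v / (u * w) = v / w.
Proof. by move=> u0; rewrite -mulf_div mulfV// mul1r. Qed.

Lemma macd_factor1 b x : let k := mult in
  macd_num logq k b (pc b x) / macd_den logq (pc b x) =
    qp (- (m b)%:R) * wall b (m b)%:Z x / wall b 0 x /\
  (wall b 0 x = 0 -> macd_den logq (pc b x) = 0).
Proof.
have [||dE nE] := @macd_factor_wall b x (pc b x) 1 0.
- by rewrite mul1r characterE.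
- by rewrite mulr0 qpow0 mulr1.
rewrite /= nE dE addr0; split=> [|->]; last by rewrite mulr0.
by apply: fraction_cancel; rewrite mulr1 invr_eq0 qpow_neq0.
Qed.

Lemma macd_factor2 b x : let k := mult in
  macd_num logq k b (1 + pc b x) / macd_den logq (1 + pc b x) =
    qp (- (m b)%:R) * wall b ((m b)%:Z - 1) x / wall b (-1) x /\
  (wall b (-1) x = 0 -> macd_den logq (1 + pc b x) = 0).
Proof.
have [||dE nE] := @macd_factor_wall b x (1 + pc b x) (qp 2) (-1).
- by rewrite mulrDr mulr1 qpowD characterE.
- by rewrite mulrNz mulrN mulr1 qpowN mulfV// qpow_neq0.
rewrite /= nE dE; split=> [|->]; last by rewrite mulr0.
by apply: fraction_cancel; rewrite mulf_neq0 ?invr_eq0 ?qpow_neq0.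
Qed.

(** The cleared identity determines the quotient at every regular point: the
    factors of the denominator vanishing there occur in all cleared
    coefficients and cancel as functions. *)
Lemma numerator_regular c f g x0 : wpoly f -> wpoly g ->
  (forall x, numerator c f x = denominator x * g x) ->
  macd_regular G Phi logq pw x0 ->
  \sum_(t <- O) macd_coef G Phi logq mult t x0 * (f (x0 + cplx t) - f x0)
    + c * f x0 = g x0.
Proof.
move=> fP gP gE reg.
pose P1 b := wall b 0 x0 != 0; pose P2 b := wall b (-1) x0 != 0.
have reg1 t b : t \in O -> b \in Phi -> 0 < ip b t -> P1 b.
  move=> /orbit_fsetP tO bP bt; have [/(_ bt) + _] := reg t b tO bP.
  by apply: contra_neq; have [] := macd_factor1 b x0.
have reg2 t b : t \in O -> b \in Phi -> ip b t == 2 -> P2 b.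
  move=> /orbit_fsetP tO bP /eqP bt; have [_ /(_ bt) +] := reg t b tO bP.
  by apply: contra_neq; have [] := macd_factor2 b x0.
pose rest1 x := \prod_(b <- Phi | ~~ P1 b) wall b 0 x.
pose rest2 x := \prod_(b <- Phi | ~~ P2 b) wall b (-1) x.
pose cR t x := (\prod_(b <- Phi | P1 b) factor1 b t x) *
   \prod_(b <- Phi | P2 b) factor2 b t x.
pose dR x := (\prod_(b <- Phi | P1 b) wall b 0 x) *
   \prod_(b <- Phi | P2 b) wall b (-1) x.
have cE t x : t \in O -> cleared_coef t x = rest1 x * (rest2 x * cR t x).
  move=> tO; rewrite /cleared_coef (bigID P1) [X in _ * X](bigID P2) /=.
  have -> : \prod_(b <- Phi | ~~ P1 b) factor1 b t x = rest1 x.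
    rewrite /rest1 big_seq_cond [RHS]big_seq_cond; apply: eq_bigr => b /andP[bP Pb].
    by rewrite /factor1; case: ifP => // /(reg1 _ _ tO bP); rewrite (negPf Pb).
  have -> : \prod_(b <- Phi | ~~ P2 b) factor2 b t x = rest2 x.
    rewrite /rest2 big_seq_cond [RHS]big_seq_cond; apply: eq_bigr => b /andP[bP Pb].
    by rewrite /factor2; case: ifP => // /(reg2 _ _ tO bP); rewrite (negPf Pb).
  by rewrite mulrACA mulrC -mulrA.
have dE x : denominator x = rest1 x * (rest2 x * dR x).
  by rewrite /denominator (bigID P1) [X in _ * X](bigID P2) /= mulrACA mulrC -mulrA.
have cRP t : wpoly (cR t).
  by apply: wpolyM; apply: wpoly_prod => b bP _;
  [exact: wpoly_factor1|exact: wpoly_factor2].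
have dRP : wpoly dR.
  by apply: wpolyM; apply: wpoly_prod => b bP _; exact: wpoly_wall.
pose N x := \sum_(t <- O) cR t x * (f (x + cplx t) - f x) + c * (dR x * f x) - dR x * g x.
have NP : wpoly N.
  apply: wpolyB; last exact: wpolyM.
  apply: wpolyD; last exact/wpolyZ/wpolyM.
  apply: wpoly_sum => t _ _; apply: wpolyM => //.
  by apply: wpolyB => //; exact: wpoly_shift.
have restN x : rest1 x * (rest2 x * N x) = 0.
  have := gE x; rewrite /N /numerator dE.
  rewrite (eq_big_seq (fun t =>
    rest1 x * (rest2 x * (cR t x * (f (x + cplx t) - f x))))); last first.
    by move=> t tO; rewrite cE// -!mulrA.
  rewrite -!mulr_sumr; move: (\sum_(_ <- _) _) => S E.
  rewrite !mulrBr [X in _ - X](_ : _ = rest1 x * (rest2 x * dR x) * g x).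
    2: by rewrite -!mulrA.
  by rewrite -E; move: (rest1 x) (rest2 x) (dR x) (f x) => u v w z; ring.
have N0 : forall x, N x = 0.
  apply: (@wall_prod_cancel Phi (predC P2) (-1)) => // y.
  have r2P : wpoly (fun x => rest2 x * N x).
    by apply: wpolyM => //; apply: wpoly_prod => b bP _; exact: wpoly_wall.
  exact: (@wall_prod_cancel Phi (predC P1) 0 _ _ r2P restN).
have d0 : dR x0 != 0.
  by rewrite mulf_neq0// prodf_seq_neq0; apply/allP => b _; apply/implyP.
apply: (mulfI d0); have /eqP := N0 x0; rewrite /N subr_eq0 => /eqP <-.
rewrite mulrDr mulrCA; congr (_ + _); rewrite mulr_sumr; apply: eq_big_seq => t tO.
rewrite mulrA; congr (_ * _); rewrite /dR /cR /macd_coef mulrACA; congr (_ * _).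
  rewrite 2!big_mkcond [X in _ * X]big_mkcond [RHS]big_mkcond -big_split /=.
  apply: eq_big_seq => b bP; rewrite /factor1.
  case: ifP => [Pb|nPb]; last first.
    by case: ifP => [/(reg1 _ _ tO bP)|_]; rewrite ?nPb// mulr1.
  case: ifP => _; last by rewrite mulr1.
  by have [-> _] := macd_factor1 b x0; rewrite mulrC divfK.
rewrite 2!big_mkcond [X in _ * X]big_mkcond [RHS]big_mkcond -big_split /=.
apply: eq_big_seq => b bP; rewrite /factor2.
case: ifP => [Pb|nPb]; last first.
  by case: ifP => [/(reg2 _ _ tO bP)|_]; rewrite ?nPb// mulr1.
case: ifP => _; last by rewrite mulr1.
by have [-> _] := macd_factor2 b x0; rewrite mulrC divfK.
Qed.

Lemma macdonald_preserves_quasi_invariants f :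
  quasi_invariants G Phi Phip logq m f ->
  macdonald_image_in G Phi Phip logq mult pw f
    (quasi_invariants G Phi Phip logq m).
Proof.
move=> fq; have [fP _] := fq.
pose c := \sum_(t \in orbit) qp (- (2 * pairC G (rho Phip mult) (cplx t))).
have [g gP gE] := denominator_divides_numerator c fq.
exists g; first exact: quotient_quasi_invariant fq gP gE.
move=> x reg; rewrite /macdonald -/c fsbig_finite; last exact: finite_orbit.
exact: (numerator_regular fP gP gE reg).
Qed.

End RootSystem.

(** * The theorem *)

Theorem proposition2p1 (R : realType) (n : nat) (G : 'M[R]_n)
    (Phi Phip : {fset 'rV[R]_n}) (q logq : R[i]) (m : 'rV[R]_n -> nat)
    (pi : 'rV[R]_n)
    (hG : scalar_product G)
    (hPhi : root_system G Phi)
    (hred : reduced_root_system Phi)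
    (hirr : irreducible_root_system G Phi)
    (hpos : positive_roots Phi Phip)
    (hlogq : cexp logq = q)
    (hq : forall N : nat, (0 < N)%N -> q ^+ N != 1)
    (hm : weyl_invariant G Phi m)
    (hpi : minuscule_or_quasi G Phi pi) :
  forall f : 'rV[R[i]]_n -> R[i],
    quasi_invariants G Phi Phip logq m f ->
    macdonald_image_in G Phi Phip logq (fun a => - (m a)%:R) pi f
      (quasi_invariants G Phi Phip logq m).
Proof.
move=> f; apply: (macdonald_preserves_quasi_invariants hG hPhi hred _ hpos hm hpi).
move=> k k0; rewrite -[k%:R]mul1r qpowMn /qpow mul1r hlogq; exact: hq.
Qed.
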